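(* Let $r>0$ and let $X$ be the $d$-dimensional Black-Scholes model with discount rate $r$ and volatility vector $\sigma=(\sigma_1,\dots,\sigma_d)$, $\sigma_i>0$, i.e. under the risk-neutral measures $(\mathbb{P}^x)_{x\in\mathbb{R}^d}$ one has $(X_i)_t=(X_i)_0+\sigma_iB^{(i)}_t+\left(r-\frac{\sigma_i^2}{2}\right)t$ for all $t>0$ and $i\in\{1,\dots,d\}$, where $B^{(1)},\dots,B^{(d)}$ are independent normalised one-dimensional Brownian motions and $X_0=x$ $\mathbb{P}^x$-a.s. Let $G=\gamma+\{x\in\mathbb{R}^d:\ {}^t\alpha x<0\}$ for some $\gamma\in\mathbb{R}^d$ and $\alpha\in\mathbb{R}^d\setminus\{0\}$. Let $\delta:=\sqrt{\sum_{i=1}^d|\alpha_i\sigma_i|^2}$ and $\mu:={}^t\left(r-\frac{\sigma_1^2}{2},\dots,r-\frac{\sigma_d^2}{2}\right)$. (i) If ${}^t\alpha\mu\ge0$, then there exist constants $c_0,C_0>0$ such that for all sufficiently small $s>0$, $$c_0s^{\frac12}\le\rho(s)(\gamma)\le C_0s^{\frac{1}{2\sqrt2}}.$$ (ii) If both ${}^t\alpha\mu\le0$ and $r>\frac{|{}^t\alpha\mu|^2}{2\delta^2}$, then there exist constants $c_1,C_1>0$ such that for all sufficiently small $s>0$, $$c_1s^{\frac{1}{\sqrt2}}\le\rho(s)(\gamma)\le C_1s^{\frac12}.$$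
   Context: ${}^ty$ denotes the transpose of $y$, so ${}^t\alpha x$ is the Euclidean inner product. $\mathbb{N}=\{1,2,\dots\}$; $\mathbb{E}^x$ is expectation under $\mathbb{P}^x$. For $t>0$, $\tau_G^{t\mathbb{N}}:=\min\{u\in t\mathbb{N}:X_u\in G\}$ ($=+\infty$ if there is no such $u$, with $e^{-r\cdot\infty}=0$), and $$\rho(s)(x):=\lim_{t\downarrow0}\mathbb{E}^x\left[e^{-r\tau_G^{t\mathbb{N}}}-e^{-r\tau_G^{s\mathbb{N}}}\right].$$ *)

(* Defs.v *)
From mathcomp Require Import all_boot all_order all_algebra.
From mathcomp Require Import all_classical all_reals all_analysis.

Set Implicit Arguments.
Unset Strict Implicit.
Unset Printing Implicit Defensive.

Import Order.TTheory GRing.Theory Num.Theory.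
Import numFieldNormedType.Exports.

Local Open Scope classical_set_scope.
Local Open Scope ring_scope.

Definition inner (R : realType) (d : nat) (a x : 'cV[R]_d) : R :=
  (a^T *m x) 0 0.

Definition halfspace (R : realType) (d : nat) (gamma alpha : 'cV[R]_d) :
    set 'cV[R]_d :=
  [set gamma + x | x in [set x | inner alpha x < 0]].

Section processes.
Context (R : realType) (disp : measure_display) (T : measurableType disp).

Definition mutually_independent (P : probability T R) (I : finType)
    (F : I -> set (set T)) : Prop :=
  forall (J : {set I}) (E : I -> set T), (forall i, i \in J -> F i (E i)) ->
    P (\bigcap_(i in [set` J]) E i) = (\prod_(i in J) P (E i))%E.

(* Processes are indexed by R, but only their values at times t >= 0 matter. *)
Definition sigma_process (B : R -> T -> R) : set (set T) :=
  <<s \bigcup_(t in `[0, +oo[) preimage_set_system setT (B t) measurable >>.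

(* The second parameter of normal_prob is the standard deviation. *)
Record brownian_motion (P : probability T R) (B : R -> T -> R) : Prop := {
  bm_measurable : forall t, 0 <= t -> measurable_fun setT (B t) ;
  bm_start : {ae P, forall w, B 0 w = 0} ;
  bm_gaussian : forall s t, 0 <= s -> s < t -> forall A : set R, measurable A ->
    P ((fun w => B t w - B s w) @^-1` A) = normal_prob 0 (Num.sqrt (t - s)) A ;
  bm_increments : forall (n : nat) (t : nat -> R), 0 <= t 0%N ->
    (forall k, (k < n)%N -> t k < t k.+1) ->
    mutually_independent P (fun k : 'I_n =>
      preimage_set_system setT (fun w => B (t k.+1) w - B (t k) w) measurable) ;
  bm_continuous :
    {ae P, forall w, {within `[0, +oo[, continuous (fun t => B t w)}}
}.

Definition bs_drift (d : nat) (r : R) (sigma : 'cV[R]_d) : 'cV[R]_d :=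
  \col_i (r - sigma i 0 ^+ 2 / 2).

(* X is the vector of logarithmic prices, and P x is the risk-neutral measure
   for the starting point x. *)
Record black_scholes (d : nat) (r : R) (sigma : 'cV[R]_d)
    (P : 'cV[R]_d -> probability T R) (X : R -> T -> 'cV[R]_d) : Prop := {
  bs_measurable : forall t i, 0 <= t ->
    measurable_fun setT (fun w => X t w i 0) ;
  bs_start : forall x, {ae P x, forall w, X 0 w = x} ;
  bs_dynamics : forall x, exists B : 'I_d -> R -> T -> R,
    [/\ forall i, brownian_motion (P x) (B i),
        mutually_independent (P x) (fun i => sigma_process (B i)) &
        {ae P x, forall w, forall t i, 0 < t ->
          X t w i 0 = X 0 w i 0 + sigma i 0 * B i t w
                      + bs_drift r sigma i 0 * t}]
}.

(* The infimum of a subset of t * {1, 2, ...} for t > 0: it is a minimum if the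
   subset is nonempty, and +oo otherwise. *)
Definition hitting_time (d : nat) (X : R -> T -> 'cV[R]_d) (G : set 'cV[R]_d)
    (t : R) (w : T) : \bar R :=
  ereal_inf [set (n%:R * t)%:E | n in [set n | (0 < n)%N /\ G (X (n%:R * t) w)]].

(* For r > 0 this is 0 at tau = +oo, since expeR -oo = 0. *)
Definition discount (r : R) (tau : \bar R) : R := fine (expeR (- (r%:E * tau))%E).

Definition rho (d : nat) (r : R) (P : 'cV[R]_d -> probability T R)
    (X : R -> T -> 'cV[R]_d) (G : set 'cV[R]_d) (s : R) (x : 'cV[R]_d) : \bar R :=
  lim ('E_(P x)[fun w => (discount r (hitting_time X G t w)
                          - discount r (hitting_time X G s w))%R]%E @[t --> 0^'+]).

End processes.

(* Main.v *)
Require Import Defs.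
From mathcomp Require Import all_boot all_order all_algebra.
From mathcomp Require Import all_classical all_reals all_analysis.
From mathcomp Require Import measurable_realfun ring lra.

Import Order.TTheory GRing.Theory Num.Theory.
Import numFieldNormedType.Exports.

Local Open Scope classical_set_scope.
Local Open Scope ring_scope.

(** Both estimates follow from a sharper one that holds for every sign of
   [m = inner alpha mu]: for small [s], [rho(s)(gamma)] lies between two
   multiples of [sqrt s]. Since [1/(2 sqrt 2) < 1/2 < 1/sqrt 2] and [s <= 1],
   this implies the four bounds of the theorem.

   Let [Y n = inner alpha (X (n s) - gamma)]. Under [P gamma] it is a random
   walk started at [0], with independent Gaussian steps of mean [m s] and
   variance [v s], where [v = delta ^ 2]; let [N] be the first [n >= 1] with
   [Y n < 0] and [z = exp (- r s)]. The expected discount at the hitting time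
   is [E z^N], so the quantity to be estimated is the loss [1 - E z^N]. Once
   it is known to be [O(sqrt s)], the limit in the definition of [rho] exists
   and equals the loss at [s] ([rho_discount_loss]).

   The loss is the limit of [(1 - z) sum_(k < n) z^k P(N > k)], and this sum is
   compared with finite combinations of exponentials [exp (- a y)]. A step
   multiplies such an exponential by [exp (s psi a)] in expectation, where
   [psi a = a^2 v / 2 - a m] ([integral_skeletonS]). This formula, a
   consequence of the independence of the increments, is the only property of
   the walk that enters the estimates.

   - Upper bound. A function [U >= 0] with [U(y) >= (1 - z) + z E U(y + step)]
     for [y >= 0] dominates the loss: [1 - E z^N <= U(0)]
     ([discounted_survival_le]). The exact solution [1 - exp (- theta y)],
     with [psi theta = r], satisfies this with equality but is negative for
     [y < 0]; a layer of height [O(sqrt s)] made of exponentials of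
     [y / sqrt s] repairs the sign, and [U(0) = O(sqrt s)].

   - Lower bound. Optional stopping for [1 - exp (- theta y)] writes the loss
     as the discounted expectation of [exp (- theta Y_N) - 1], which is at least
     the contribution of the paths killed at the first step
     ([discounted_survival_ge]). That contribution is of order [sqrt s]
     because the first step is below [- sqrt s] with probability bounded below;
     a combination of exponentials of [y / sqrt s] lying below
     [exp (- theta y) - 1] for [y < 0] and below [0] for [y >= 0] proves it. *)

(** * Independence of a variable from the past of a sequence *)

Section independence.
Context {d : measure_display} {T : measurableType d} {R : realType}.
Variable P : probability T R.

(** The joint law of [F] and [G] is the product of their laws, so the formula is
   Tonelli's theorem. *)
Lemma expectation_prod_independent (F G : {mfun T >-> R}) :
  (forall w, 0 <= F w) -> (forall w, 0 <= G w) ->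
  (forall A B, measurable A -> measurable B ->
     P (F @^-1` A `&` G @^-1` B) = (P (F @^-1` A) * P (G @^-1` B))%E) ->
  (\int[P]_w (F w * G w)%:E = (\int[P]_w (F w)%:E) * (\int[P]_w (G w)%:E))%E.
Proof.
move=> F0 G0 FG.
have mFG : measurable_fun setT (fun w => (F w, G w)) by exact: measurable_fun_pair.
pose H : {mfun T >-> (R * R)%type} := mfun_Sub (mem_set mFG).
pose PF := distribution P F.
pose PG := distribution P G.
have PH X : measurable X -> distribution P H X = (PF \x PG)%E X.
  by move=> mX; apply/esym/product_measure_unique.
pose W : measurableType _ := (R * R)%type.
(* Absolute values make the integrand nonnegative on the whole plane, as
   Tonelli's theorem requires; F and G themselves are nonnegative. *)
pose h (x : W) : \bar R := (`|x.1| * `|x.2|)%:E.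
have mh : measurable_fun setT h.
  by apply/measurable_EFinP/measurable_funM; apply: measurableT_comp.
have h0 x : (0 <= h x)%E by rewrite lee_fin mulr_ge0.
transitivity (\int[distribution P H]_x h x)%E.
  rewrite ge0_integral_distribution//; apply: eq_integral => w _.
  by rewrite /h/= !ger0_norm.
transitivity (\int[(PF \x PG)%E]_x h x)%E.
  by apply: eq_measure_integral => X mX _; exact: PH.
rewrite fubini_tonelli1// /fubini_F.
have mabs : measurable_fun setT (fun x : R => `|x|%:E).
  by apply/measurable_EFinP; exact: normr_measurable.
under eq_integral.
  move=> x _; rewrite /h/=.
  under eq_integral do rewrite EFinM.
  rewrite ge0_integralZl_EFin//.
  over.
rewrite ge0_integralZr//; last exact: integral_ge0.
rewrite !ge0_integral_distribution//.
by congr (_ * _)%E; apply: eq_integral => w _ /=; rewrite ger0_norm.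
Qed.

(** The generated sigma-algebra [<<s cylinder V n >>] is the past of [V] before
   time [n]; finite-dimensional cylinders form a pi-system generating it. *)
Definition cylinder (V : nat -> T -> R) (n : nat) : set (set T) :=
  [set A | exists2 E : nat -> set R, (forall k, measurable (E k)) &
           A = \bigcap_(k in `I_n) V k @^-1` E k].

Definition independent_seq (V : nat -> T -> R) :=
  forall n (E : nat -> set R), (forall k, measurable (E k)) ->
    P (\bigcap_(k in `I_n) V k @^-1` E k) = (\prod_(k < n) P (V k @^-1` E k))%E.

Variable V : nat -> {mfun T >-> R}.

Lemma preimage_bigcapI n (E1 E2 : nat -> set R) :
  \bigcap_(k in `I_n) V k @^-1` E1 k `&` \bigcap_(k in `I_n) V k @^-1` E2 k =
  \bigcap_(k in `I_n) V k @^-1` (E1 k `&` E2 k).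
Proof. by rewrite -bigcapI. Qed.

Lemma cylinder_setI_closed n : setI_closed (cylinder V n).
Proof.
move=> _ _ [E1 mE1 ->] [E2 mE2 ->].
exists (fun k => E1 k `&` E2 k); last by rewrite preimage_bigcapI.
by move=> k; exact: measurableI.
Qed.

Lemma cylinder_setT n : cylinder V n setT.
Proof.
by exists (fun=> setT) => //; apply/esym; rewrite -subTset => w _ k _.
Qed.

Lemma cylinder_measurable n : cylinder V n `<=` measurable.
Proof.
move=> _ [E mE ->]; apply: bigcap_measurableType => // k _.
by rewrite -[X in measurable X]setTI; exact: measurable_funPT.
Qed.

Lemma past_measurable n (A : set T) : <<s cylinder V n >> A -> measurable A.
Proof.
apply: smallest_sub; first exact: sigma_algebra_measurable.
exact: cylinder_measurable.
Qed.

Lemma cylinderS n (A : set T) : cylinder V n A -> cylinder V n.+1 A.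
Proof.
move=> [E mE ->]; exists (fun k => if k == n then setT else E k).
  by move=> k; case: ifP.
apply/seteqP; split => w /= h k /=.
  by move=> kn; case: ifPn => // kN; apply: h => /=; rewrite ltn_neqAle kN.
by move=> kn; have := h k (ltnW kn); rewrite (ltn_eqF kn).
Qed.

(** Independence is given on cylinders only; both sides are finite measures in
   [A], so equality extends from the pi-system to the sigma-algebra. *)
Lemma past_independent n (A : set T) (E : set R) : independent_seq V ->
  <<s cylinder V n >> A -> measurable E ->
  P (A `&` V n @^-1` E) = (P A * P (V n @^-1` E))%E.
Proof.
move=> indV sA mE.
have mVE : measurable (V n @^-1` E).
  by rewrite -[X in measurable X]setTI; exact: measurable_funPT.
pose m1 := mrestr P mVE.
have c0 : 0 <= fine (P (V n @^-1` E)) by rewrite fine_ge0.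
pose m2 := mscale (NngNum c0) P.
rewrite -[LHS]/(m1 A).
have -> : (P A * P (V n @^-1` E))%E = m2 A.
  by rewrite /m2/= /mscale/= fineK ?fin_num_measure// muleC.
apply: (g_sigma_algebra_measure_unique (cylinder V n) _ (fun=> setT)) => //.
- exact: cylinder_measurable.
- by move=> _; exact: cylinder_setT.
- by rewrite bigcup_const.
- exact: cylinder_setI_closed.
- move=> _ [F mF ->]; rewrite /m1 /m2/= /mscale/mrestr/= fineK ?fin_num_measure//.
  rewrite [in RHS]indV// muleC.
  pose F' k := if k == n then E else F k.
  have -> : \bigcap_(k in `I_n) V k @^-1` F k `&` V n @^-1` E =
            \bigcap_(k in `I_n.+1) V k @^-1` F' k.
    apply/seteqP; split => w /=.
      move=> [h hn] k /=; rewrite ltnS leq_eqVlt => /predU1P[->|kn].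
        by rewrite /F' eqxx.
      by rewrite /F' (ltn_eqF kn); exact: h.
    move=> h; split.
      by move=> k kn; have := h k (ltnW kn); rewrite /F' (ltn_eqF kn).
    by have := h n (ltnSn n); rewrite /F' eqxx.
  rewrite indV; last by move=> k; rewrite /F'; case: ifP.
  rewrite big_ord_recr/= /F' eqxx; congr (_ * _)%E.
  by apply: eq_bigr => i _; rewrite (ltn_eqF (ltn_ord i)).
- by move=> _; rewrite /m1/= /mrestr setTI ltey_eq fin_num_measure.
Qed.
Section walk.
Hypothesis indV : independent_seq V.
Variable c : nat -> R.

Definition walk n w := \sum_(k < n) c k * V k w.

Lemma walkS n w : walk n.+1 w = walk n w + c n * V n w.
Proof. by rewrite /walk big_ord_recr. Qed.

(** Adaptedness of the walk: measurability is with respect to the past, not only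
   to the ambient sigma-algebra. *)
Lemma past_measurable_walk n :
  measurable_fun [set: g_sigma_algebraType (cylinder V n)] (walk n).
Proof.
apply: measurable_sum => k; apply: measurable_funM => //.
move=> _ B mB; rewrite setTI; apply: sub_sigma_algebra.
exists (fun j : nat => if j == k :> nat then B else setT); first by move=> j; case: ifP.
apply/seteqP; split => w /=.
  by move=> Bw j _ /=; case: eqP => [->|].
by move=> /(_ k (ltn_ord k)) /=; rewrite eqxx.
Qed.

Lemma measurable_walk n : measurable_fun setT (walk n).
Proof. by apply: measurable_sum => k; exact: measurable_funM. Qed.

Variable s : R.
Hypothesis mgfV : forall k b,
  (\int[P]_w (expR (b * V k w))%:E = (expR (b ^+ 2 * s / 2))%:E)%E.

(** The indicator of [A] times the exponential of the walk is a function of the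
   past, hence independent of [V n], and the expectation factorizes. *)
Lemma integral_walkS n (A : set T) a : <<s cylinder V n >> A ->
  (\int[P]_(w in A) (expR (- a * walk n.+1 w))%:E =
   (\int[P]_(w in A) (expR (- a * walk n w))%:E) *
     (expR (a ^+ 2 * c n ^+ 2 * s / 2))%:E)%E.
Proof.
move=> sA; have mA := past_measurable n A sA.
have mF' : measurable_fun [set: g_sigma_algebraType (cylinder V n)]
    (fun w => \1_A w * expR (- a * walk n w)).
  apply: measurable_funM; first exact: measurable_indic.
  apply: measurableT_comp => //; apply: measurable_funM => //.
  exact: past_measurable_walk.
have mF : measurable_fun setT (fun w => \1_A w * expR (- a * walk n w)).
  apply: measurable_funM; first exact: measurable_indic.
  apply: measurableT_comp => //; apply: measurable_funM => //.
  exact: measurable_walk.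
have mG : measurable_fun setT (fun w => expR (- a * c n * V n w)).
  by apply: measurableT_comp => //; exact: measurable_funM.
pose F : {mfun T >-> R} := mfun_Sub (mem_set mF).
pose G : {mfun T >-> R} := mfun_Sub (mem_set mG).
have := expectation_prod_independent F G.
rewrite /= mgfV (_ : (- a * c n) ^+ 2 = a ^+ 2 * c n ^+ 2); last by ring.
have EA b : (\int[P]_(w in A) (b w)%:E = \int[P]_w (\1_A w * b w)%:E)%E.
  rewrite integral_mkcond; apply: eq_integral => w _.
  by rewrite patchE indicE; case: ifPn => _; rewrite ?mul1r ?mul0r.
move=> FG; rewrite (EA (fun w => expR (- a * walk n w))) -FG.
- rewrite (EA (fun w => expR (- a * walk n.+1 w))).
  by apply: eq_integral => w _; rewrite walkS mulrDr expRD !mulrA.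
- by move=> w; rewrite mulr_ge0.
- by move=> w; exact: expR_ge0.
- move=> B C mB mC.
  have -> : (fun w => expR (- a * c n * V n w)) @^-1` C =
            V n @^-1` ((fun x => expR (- a * c n * x)) @^-1` C) by [].
  apply: past_independent => //.
    by have := mF' measurableT B mB; rewrite setTI.
  rewrite -[X in measurable X]setTI.
  suff : measurable_fun setT (fun x : R => expR (- a * c n * x)) by exact.
  by apply: measurableT_comp => //; exact: measurable_funM.
Qed.

Lemma integral_walk_shift n m (A : set T) a : <<s cylinder V n >> A ->
  (\int[P]_(w in A) (expR (- a * walk (n + m) w))%:E =
   (\int[P]_(w in A) (expR (- a * walk n w))%:E) *
     (expR (a ^+ 2 * (\sum_(k < m) c (n + k)%N ^+ 2) * s / 2))%:E)%E.
Proof.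
move=> sA; elim: m => [|m IH].
  by rewrite addn0 big_ord0 mulr0 !mul0r expR0 mule1.
have sAm : <<s cylinder V (n + m) >> A.
  elim: {IH} m => [|m IH]; first by rewrite addn0.
  rewrite addnS; move: IH; apply: sub_sigma_algebra2 => B.
  exact: cylinderS.
rewrite addnS integral_walkS// IH -muleA -EFinM -expRD big_ord_recr/=.
by congr (_ * (expR _)%:E)%E; ring.
Qed.

End walk.
End independence.

(** * The Laplace transform of the normal law *)

(** The Radon-Nikodym derivative of [normal_prob] is almost everywhere its
   density, by uniqueness. *)
Lemma ge0_integral_normal_prob (R : realType) (m sd : R) (f : R -> \bar R) :
  measurable_fun setT f -> (forall x, 0 <= f x)%E ->
  (\int[normal_prob m sd]_x f x =
   \int[lebesgue_measure]_x (f x * (normal_pdf m sd x)%:E))%E.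
Proof.
move=> mf f0.
have dom := normal_prob_dominates m sd.
rewrite -(Radon_Nikodym_SigmaFinite.change_of_variables dom)//=.
apply: ae_eq_integral => //.
- apply: emeasurable_funM => //; apply: measurable_int.
  exact: Radon_Nikodym_SigmaFinite.f_integrable.
- apply: emeasurable_funM => //; apply/measurable_EFinP.
  exact: measurable_normal_pdf.
- apply: ae_eqe_mul2l; apply: integral_ae_eq => //.
  + exact: Radon_Nikodym_SigmaFinite.f_integrable.
  + by apply/measurable_EFinP; exact: measurable_normal_pdf.
  + by move=> A _ mA; rewrite -Radon_Nikodym_SigmaFinite.f_integral.
Qed.

(** Completing the square: up to a constant, the exponential weight shifts the
   mean of the normal density from [0] to [b * s]. *)
Lemma mgf_normal (R : realType) (s b : R) : 0 < s ->
  (\int[normal_prob 0 (Num.sqrt s)]_x (expR (b * x))%:E =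
   (expR (b ^+ 2 * s / 2))%:E)%E.
Proof.
move=> s0.
have sd0 : Num.sqrt s != 0 by rewrite gt_eqF// sqrtr_gt0.
rewrite ge0_integral_normal_prob; last 2 first.
- by apply/measurable_EFinP/measurableT_comp => //; exact: measurable_funM.
- by move=> x; rewrite lee_fin expR_ge0.
transitivity (\int[lebesgue_measure]_x ((expR (b ^+ 2 * s / 2))%:E *
    (normal_pdf (b * s) (Num.sqrt s) x)%:E))%E.
  apply: eq_integral => x _; rewrite -!EFinM; congr EFin.
  rewrite !normal_pdfE// [LHS]mulrCA [RHS]mulrCA; congr (_ * _).
  rewrite /normal_fun -!expRD sqr_sqrtr ?(ltW s0)//; congr expR.
  by field; rewrite gt_eqF.
rewrite ge0_integralZl_EFin ?expR_ge0//.
- by rewrite integral_normal_pdf mule1.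
- by move=> x _; rewrite lee_fin normal_pdf_ge0.
- by apply/measurable_EFinP; exact: measurable_normal_pdf.
Qed.
(** * First passage of a process with exponential one-step averages *)

(** A finite combination of exponentials, as a list of pairs (coefficient,
   rate). *)
Definition expsum {R : realType} (l : seq (R * R)) (y : R) : R :=
  \sum_(p <- l) p.1 * expR (- p.2 * y).

Section first_passage.
Context {d : measure_display} {T : measurableType d} {R : realType}.
Variable P : probability T R.

Lemma Rintegral_expsum_ge0 (A : set T) (Y : T -> R) (l : seq (R * R)) :
  measurable A ->
  (forall a, P.-integrable A (fun w => (expR (- a * Y w))%:E)) ->
  (forall w, A w -> 0 <= expsum l (Y w)) ->
  0 <= \sum_(p <- l) p.1 * (\int[P]_(w in A) expR (- p.2 * Y w)).
Proof.
move=> mA iA l0.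
suff [_ <-] : P.-integrable A (EFin \o (fun w => expsum l (Y w))) /\
    \int[P]_(w in A) expsum l (Y w) =
    \sum_(p <- l) p.1 * (\int[P]_(w in A) expR (- p.2 * Y w)).
  exact: Rintegral_ge0.
elim: l {l0} => [|p l [il IH]].
  have -> : (fun w => expsum [::] (Y w)) = cst 0.
    by apply/funext => w; rewrite /expsum big_nil.
  by rewrite big_nil Rintegral_cst// mul0r; split => //; exact: integrable0.
rewrite big_cons -IH.
have ip : P.-integrable A (EFin \o (fun w => p.1 * expR (- p.2 * Y w))).
  by rewrite (_ : _ \o _ = (fun w => p.1%:E * (expR (- p.2 * Y w))%:E)%E)//;
    exact: integrableZl.
have E w : expsum (p :: l) (Y w) = p.1 * expR (- p.2 * Y w) + expsum l (Y w).
  by rewrite /expsum big_cons.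
split.
  rewrite (_ : _ \o _ = fun w => ((p.1 * expR (- p.2 * Y w))%R%:E +
    (expsum l (Y w))%:E)%E); first exact: integrableD.
  by apply/funext => w /=; rewrite E EFinD.
under eq_Rintegral do rewrite E.
by rewrite RintegralD// RintegralZl//; exact: iA.
Qed.

Variable Y : nat -> T -> R.
Hypothesis mY : forall n, measurable_fun setT (Y n).
Hypothesis Y0 : forall w, Y 0 w = 0.

(** Survival starts at time 1: the initial position, which is on the boundary,
   is never tested. *)
Definition alive n : set T := [set w | forall k, (k < n)%N -> 0 <= Y k.+1 w].

Definition dies n : set T := alive n `&` [set w | Y n.+1 w < 0].

Lemma alive0 : alive 0 = setT.
Proof. by rewrite -subTset. Qed.

Lemma alive_split n : alive n = alive n.+1 `|` dies n.
Proof.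
apply/seteqP; split => w /=.
  move=> h; have [Yn|Yn] := leP 0 (Y n.+1 w); last by right.
  left=> k; rewrite ltnS leq_eqVlt => /predU1P[->//|]; exact: h.
by move=> [h k kn|[]//]; apply: h; rewrite (ltn_trans kn).
Qed.

Lemma alive_dies_disjoint n : [disjoint alive n.+1 & dies n].
Proof.
apply/disj_setPS => w [h [_ /=]]; rewrite ltNge.
by rewrite (h n (ltnSn n)).
Qed.

Lemma alive_ge0 n w : alive n w -> 0 <= Y n w.
Proof. by case: n => [_|n h]; [rewrite Y0|exact: h]. Qed.

Lemma measurable_alive n : measurable (alive n).
Proof.
rewrite (_ : alive n = \bigcap_(k in `I_n) Y k.+1 @^-1` `[0, +oo[); last first.
  apply/seteqP; split => w h k /=.
    by rewrite in_itv/= andbT => kn; exact: h.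
  by move=> kn; have := h k kn; rewrite /= in_itv/= andbT.
apply: bigcap_measurableType => // k _.
by rewrite -[X in measurable X]setTI; exact: mY.
Qed.

Lemma measurable_dies n : measurable (dies n).
Proof.
apply: measurableI; first exact: measurable_alive.
rewrite (_ : [set w | _] = Y n.+1 @^-1` `]-oo, 0[); last first.
  by apply/seteqP; split => w /=; rewrite in_itv.
by rewrite -[X in measurable X]setTI; exact: mY.
Qed.

(* g a is the Laplace transform at a of one step: the process enters only
   through these averages on the surviving paths. *)
Variable g : R -> R.
Hypothesis Ystep : forall n a,
  (\int[P]_(w in alive n) (expR (- a * Y n.+1 w))%:E =
   (\int[P]_(w in alive n) (expR (- a * Y n w))%:E) * (g a)%:E)%E.

Let mexp n a A : measurable A -> measurable_fun A (fun w => (expR (- a * Y n w))%:E).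
Proof.
move=> mA; apply: measurable_funTS.
by apply/measurable_EFinP/measurableT_comp => //; exact: measurable_funM.
Qed.

Let Esub n A B a : measurable A -> measurable B -> A `<=` B ->
  (\int[P]_(w in A) (expR (- a * Y n w))%:E <=
   \int[P]_(w in B) (expR (- a * Y n w))%:E)%E.
Proof.
move=> mA mB AB; apply: ge0_subset_integral => //; first exact: mexp.
Qed.

Lemma integral_alive_fin n a :
  (\int[P]_(w in alive n) (expR (- a * Y n w))%:E < +oo)%E.
Proof.
elim: n => [|n IH].
  under eq_integral do rewrite Y0 mulr0 expR0.
  by rewrite integral_cst ?mul1e ?ltey_eq ?fin_num_measure//; exact: measurable_alive.
apply: (@le_lt_trans _ _ (\int[P]_(w in alive n) (expR (- a * Y n.+1 w))%:E)%E).
  apply: Esub; [exact: measurable_alive|exact: measurable_alive|].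
  by rewrite [X in _ `<=` X]alive_split; exact: subsetUl.
rewrite Ystep; move: IH; have : (0 <= \int[P]_(w in alive n) (expR (- a * Y n w))%:E)%E.
  by apply: integral_ge0 => w _; rewrite lee_fin expR_ge0.
by case: (\int[P]_(w in alive n) _)%E => // r _ _; rewrite -EFinM ltry.
Qed.

Let integrable_lty n A a : measurable A ->
  (\int[P]_(w in A) (expR (- a * Y n w))%:E < +oo)%E ->
  P.-integrable A (fun w => (expR (- a * Y n w))%:E).
Proof.
move=> mA h; apply/integrableP; split; first exact: mexp.
by under eq_integral do rewrite /= ger0_norm ?expR_ge0//.
Qed.

Lemma integrable_alive n a :
  P.-integrable (alive n) (fun w => (expR (- a * Y n w))%:E).
Proof.
apply: integrable_lty; first exact: measurable_alive.
exact: integral_alive_fin.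
Qed.

Lemma integrable_aliveS n a :
  P.-integrable (alive n) (fun w => (expR (- a * Y n.+1 w))%:E).
Proof.
apply: integrable_lty; first exact: measurable_alive.
rewrite Ystep; have := integral_alive_fin n a.
have : (0 <= \int[P]_(w in alive n) (expR (- a * Y n w))%:E)%E.
  by apply: integral_ge0 => w _; rewrite lee_fin expR_ge0.
by case: (\int[P]_(w in alive n) _)%E => // r _ _; rewrite -EFinM ltry.
Qed.

Lemma integrable_dies n a :
  P.-integrable (dies n) (fun w => (expR (- a * Y n.+1 w))%:E).
Proof.
apply: integrableS (integrable_aliveS n a).
- exact: measurable_alive.
- exact: measurable_dies.
- exact: subIsetl.
Qed.

(** The Laplace transforms of the position on the paths that survive, and on
   the paths that are killed at the next step. *)
Definition laplace_alive n a := \int[P]_(w in alive n) expR (- a * Y n w).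
Definition laplace_dies n a := \int[P]_(w in dies n) expR (- a * Y n.+1 w).

(** One step of the process, split according to whether the path survives it. *)
Lemma laplace_alive_step n a :
  laplace_alive n a * g a = laplace_alive n.+1 a + laplace_dies n a.
Proof.
rewrite [X in _ = X + _]/laplace_alive /laplace_dies.
rewrite -Rintegral_setU -?alive_split.
- apply: (etrans _ (congr1 fine (esym (Ystep n a)))).
  apply/esym/fineM => //.
  by apply: integrable_fin_num; [exact: measurable_alive|exact: integrable_alive].
- exact: measurable_alive.
- exact: measurable_dies.
- exact: integrable_aliveS.
- exact: alive_dies_disjoint.
Qed.

Lemma laplace_alive_expsum_ge0 n l :
  (forall y, 0 <= y -> 0 <= expsum l y) ->
  0 <= \sum_(p <- l) p.1 * laplace_alive n p.2.
Proof.
move=> l0; apply: Rintegral_expsum_ge0.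
- exact: measurable_alive.
- by move=> a; exact: integrable_alive.
- by move=> w /alive_ge0 /l0.
Qed.

Lemma laplace_dies_expsum_ge0 n l :
  (forall y, y < 0 -> 0 <= expsum l y) ->
  0 <= \sum_(p <- l) p.1 * laplace_dies n p.2.
Proof.
move=> l0; apply: (@Rintegral_expsum_ge0 _ (Y n.+1)).
- exact: measurable_dies.
- by move=> a; exact: integrable_dies.
- by move=> w [_] /l0.
Qed.

Lemma laplace_alive0 a : laplace_alive 0 a = 1.
Proof.
rewrite /laplace_alive alive0; under eq_Rintegral do rewrite Y0 mulr0 expR0.
rewrite Rintegral_cst; last exact: measurableT.
by rewrite mul1r; exact: (congr1 fine (probability_setT P)).
Qed.

Definition survival n : R := fine (P (alive n)).

Lemma laplace_alive_survival n : laplace_alive n 0 = survival n.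
Proof.
rewrite /laplace_alive; under eq_Rintegral do rewrite oppr0 mul0r expR0.
by rewrite Rintegral_cst ?mul1r//; exact: measurable_alive.
Qed.

Variable z : R.
Hypothesis z01 : 0 < z < 1.

Let z0 : 0 < z. Proof. by case/andP: z01. Qed.
Let z1 : z < 1. Proof. by case/andP: z01. Qed.

(** With [N] the killing time, this is the expectation of
   [1 - z ^+ minn N n]. *)
Definition discounted_survival n := (1 - z) * \sum_(k < n) z ^+ k * survival k.

Lemma discounted_survivalS n :
  discounted_survival n.+1 =
  discounted_survival n + z ^+ n * ((1 - z) * survival n).
Proof. by rewrite /discounted_survival big_ord_recr/= mulrDr mulrCA. Qed.

(** Supersolutions dominate: on the surviving paths [E k], the expected value of
   the barrier, loses at least [(1 - z) * survival k] at each step, and what the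
   barrier is worth on the killed paths can be thrown away because the barrier
   is nonnegative. *)
Lemma discounted_survival_le (l : seq (R * R)) n :
  (forall y, 0 <= expsum l y) ->
  (forall y, 0 <= y ->
     1 - z <= expsum [seq (p.1 * (1 - z * g p.2), p.2) | p <- l] y) ->
  discounted_survival n <= expsum l 0.
Proof.
move=> l0 lz.
pose E k := \sum_(p <- l) p.1 * laplace_alive k p.2.
have E0 k : 0 <= E k by apply: laplace_alive_expsum_ge0 => y _.
have Estep k : (1 - z) * survival k + z * E k.+1 <= E k.
  have D0 : 0 <= \sum_(p <- l) p.1 * laplace_dies k p.2.
    by apply: laplace_dies_expsum_ge0 => y _.
  have Ek : E k.+1 + \sum_(p <- l) p.1 * laplace_dies k p.2 =
            \sum_(p <- l) p.1 * (laplace_alive k p.2 * g p.2).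
    rewrite -big_split/=; apply: eq_bigr => p _.
    by rewrite laplace_alive_step mulrDr.
  have := laplace_alive_expsum_ge0 k ((- (1 - z), 0) ::
    [seq (p.1 * (1 - z * g p.2), p.2) | p <- l]).
  rewrite big_cons/= laplace_alive_survival big_map/=.
  have -> : \sum_(p <- l) p.1 * (1 - z * g p.2) * laplace_alive k p.2 =
            E k - z * \sum_(p <- l) p.1 * (laplace_alive k p.2 * g p.2).
    rewrite mulr_sumr -sumrB; apply: eq_bigr => p _; ring.
  move=> H; have {}H : 0 <= - (1 - z) * survival k +
     (E k - z * (\sum_(p <- l) p.1 * (laplace_alive k p.2 * g p.2))).
    apply: H => y y0; rewrite /expsum big_cons/= oppr0 mul0r expR0 mulr1.
    by rewrite addrC subr_ge0; exact: lz.
  rewrite -Ek in H; move: H (mulr_ge0 (ltW z0) D0).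
  move: (E k) (E k.+1) (survival k) (\sum_(p <- l) _) => e e' p o; lra.
have : discounted_survival n + z ^+ n * E n <= E 0.
  elim: n => [|n IH].
    by rewrite /discounted_survival big_ord0 mulr0 add0r expr0 mul1r.
  apply: le_trans IH; rewrite discounted_survivalS -addrA lerD2l exprSr.
  have := ler_wpM2l (exprn_ge0 n (ltW z0)) (Estep n).
  by rewrite mulrDr (mulrA (z ^+ n) z).
have -> : E 0 = expsum l 0.
  by apply: eq_bigr => p _; rewrite laplace_alive0 mulr0 expR0.
have := mulr_ge0 (exprn_ge0 n (ltW z0)) (E0 n); lra.
Qed.

(** Optional stopping for the function [1 - exp (- theta y)]: the discounted
   survival up to [n.+1] is, up to a term of size [z ^+ n.+1], the sum of the
   discounted overshoot terms [O k >= 0]. Only [O 0] is kept, and it is bounded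
   below by means of the combination [l]: it lies below the overshoot function
   on the killed paths, and below [0] on the paths that survive the first
   step. *)
Lemma discounted_survival_ge (theta : R) (l : seq (R * R)) n : 0 <= theta ->
  z * g theta = 1 -> g 0 = 1 ->
  (forall y, 0 <= y -> expsum l y <= 0) ->
  (forall y, y < 0 -> expsum l y <= expR (- theta * y) - 1) ->
  z * \sum_(p <- l) p.1 * g p.2 - z ^+ n.+1 <= discounted_survival n.+1.
Proof.
move=> theta0 gtheta g0 lpos lneg.
(* L k is the expectation of 1 - exp (- theta Y_k) on the surviving paths, and
   O k that of exp (- theta Y_(k+1)) - 1 on the paths killed at step k + 1. *)
pose L k := survival k - laplace_alive k theta.
pose O k := laplace_dies k theta - laplace_dies k 0.
have O0 k : 0 <= O k.
  have := laplace_dies_expsum_ge0 k [:: (1, theta); (-1, 0)].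
  rewrite !big_cons big_nil/= addr0 mul1r mulN1r; apply => y y0.
  rewrite /expsum !big_cons big_nil/= oppr0 mul0r expR0 mul1r addr0 mulr1.
  by rewrite subr_ge0 -expR0 ler_expR mulNr -mulrN mulr_ge0// oppr_ge0 ltW.
have Lstep k : (1 - z) * survival k = L k - z * L k.+1 + z * O k.
  have := laplace_alive_step k theta; have := laplace_alive_step k 0.
  rewrite g0 mulr1 !laplace_alive_survival => h1 h2.
  have {}h2 : laplace_alive k theta =
      z * (laplace_alive k.+1 theta + laplace_dies k theta).
    by rewrite -h2 mulrCA gtheta mulr1.
  rewrite /L /O h2; move: h1.
  move: (survival k) (survival k.+1) (laplace_alive _ _) (laplace_dies k 0).
  move=> p p' e o ->; ring.
have L1 k : L k <= 1.
  rewrite /L; have := laplace_alive_expsum_ge0 k [:: (1, theta)].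
  rewrite !big_cons big_nil/= addr0 mul1r => h.
  have {}h : 0 <= laplace_alive k theta.
    by apply: h => y _; rewrite /expsum big_cons big_nil/= mul1r addr0 expR_ge0.
  have : survival k <= 1.
    rewrite /survival -lee_fin fineK ?fin_num_measure ?probability_le1//;
    exact: measurable_alive.
  lra.
have L0 : L 0 = 0.
  by rewrite /L laplace_alive0 -laplace_alive_survival laplace_alive0 subrr.
have SO m : z * O 0 <= discounted_survival m.+1 + z ^+ m.+1 * L m.+1.
  elim: m => [|m IH].
    rewrite /discounted_survival big_ord_recl big_ord0 expr0 expr1 mul1r addr0.
    rewrite (Lstep 0) L0; move: (z * O 0) (z * L 1) => x y; lra.
  apply: (le_trans IH); rewrite [in leRHS]discounted_survivalS Lstep.
  rewrite [z ^+ m.+2]exprSr.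
  have := mulr_ge0 (exprn_ge0 m.+1 (ltW z0)) (mulr_ge0 (ltW z0) (O0 m.+1)).
  move: (L m.+1) (L m.+2) (O m.+1) (z ^+ m.+1) (discounted_survival _).
  move=> u u' o zm D h; rewrite -subr_ge0 (_ : _ - _ = zm * (z * o))//; ring.
have zn1 : z ^+ n.+1 * L n.+1 <= z ^+ n.+1.
  by rewrite -[leRHS]mulr1 ler_wpM2l// exprn_ge0// ltW.
have lO : \sum_(p <- l) p.1 * g p.2 <= O 0.
  have h1 : \sum_(p <- l) p.1 * laplace_alive 1 p.2 <= 0.
    have := laplace_alive_expsum_ge0 1 [seq (- p.1, p.2) | p <- l].
    rewrite big_map/= -oppr_ge0 -sumrN; under eq_bigr do rewrite mulNr.
    apply => y /lpos; rewrite -oppr_ge0 /expsum big_map -sumrN.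
    by under [X in _ -> 0 <= X]eq_bigr do rewrite mulNr.
  have h2 : \sum_(p <- l) p.1 * laplace_dies 0 p.2 <= O 0.
    have := laplace_dies_expsum_ge0 0 ((1, theta) :: (-1, 0) :: [seq (- p.1, p.2) | p <- l]).
    rewrite !big_cons big_map/= mul1r mulN1r addrA -/(O 0).
    under eq_bigr do rewrite mulNr.
    rewrite sumrN subr_ge0; apply => y /lneg.
    rewrite -subr_ge0 /expsum !big_cons big_map/= oppr0 mul0r expR0 mul1r mulr1 addrA.
    by under [X in _ -> 0 <= _ + X]eq_bigr do rewrite mulNr; rewrite sumrN.
  have -> : \sum_(p <- l) p.1 * g p.2 = \sum_(p <- l) p.1 * laplace_alive 1 p.2 +
      \sum_(p <- l) p.1 * laplace_dies 0 p.2.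
    rewrite -big_split/=; apply: eq_bigr => p _.
    by rewrite -mulrDr -laplace_alive_step laplace_alive0 mul1r.
  lra.
have := SO n; have := ler_wpM2l (ltW z0) lO; lra.
Qed.

End first_passage.
(** * Barriers of height proportional to the square root of the time step *)

Section barriers.
Context {R : realType}.
Variables r v m : R.
Hypotheses (r0 : 0 < r) (v0 : 0 < v).

(** The logarithm, per unit of time, of [E (exp (- a Y))] for a Brownian motion
   of variance [v] and drift [m]. *)
Definition log_laplace a := a ^+ 2 * v / 2 - a * m.

(** Convexity of the exponential: the combination, with weights [p] and
   [1 - p], of its tangent inequalities at [p * x]. *)
Lemma expR_bernoulli (p x : R) : 0 <= p <= 1 ->
  expR (p * x) - 1 <= p * (expR x - 1).
Proof.
move=> /andP[p0 p1].
have e0 := expR_ge0 (p * x).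
have h1 : expR (p * x) * (1 + (1 - p) * x) <= expR x.
  have -> : expR x = expR (p * x) * expR ((1 - p) * x).
    by rewrite -expRD -mulrDl addrC subrK mul1r.
  by rewrite ler_wpM2l// expR_ge1Dx.
have h2 : expR (p * x) * (1 - p * x) <= 1.
  have : 1 - p * x <= expR (- (p * x)) by exact: expR_ge1Dx.
  by rewrite -(ler_pM2l (expR_gt0 (p * x))) -expRD subrr expR0.
have := ler_wpM2l p0 h1; have q0 : 0 <= 1 - p by lra.
have := ler_wpM2l q0 h2; nra.
Qed.

(** The positive root of [log_laplace a = r], for which discounting compensates
   one step exactly. *)
Definition wald_exponent := (m + Num.sqrt (m ^+ 2 + 2 * v * r)) / v.

Lemma wald_exponent_gt0 : 0 < wald_exponent.
Proof.
apply: divr_gt0 => //.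
suff : - m < Num.sqrt (m ^+ 2 + 2 * v * r) by lra.
have h : 0 < m ^+ 2 + 2 * v * r by rewrite ltr_wpDl ?sqr_ge0// !mulr_gt0.
rewrite (le_lt_trans (ler_norm _))// -(ltr_pXn2r (n:=2)) ?nnegrE ?sqrtr_ge0//.
by rewrite real_normK ?num_real// sqrrN sqr_sqrtr ?(ltW h)// ltrDl !mulr_gt0.
Qed.

Lemma log_laplace_wald : log_laplace wald_exponent = r.
Proof.
have h : 0 <= m ^+ 2 + 2 * v * r.
  by rewrite addr_ge0 ?sqr_ge0// !mulr_ge0// ltW.
have := sqr_sqrtr h; rewrite /log_laplace /wald_exponent.
set q := Num.sqrt _ => hq.
have -> : ((m + q) / v) ^+ 2 * v / 2 - (m + q) / v * m = (q ^+ 2 - m ^+ 2) / (2 * v).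
  by field; rewrite gt_eqF.
by rewrite hq; field; rewrite gt_eqF.
Qed.

(** The boundary layer consists of the exponentials of rates [layer_rate / b] and
   [2 * layer_rate / b], where [b] is the square root of the time step. The rate
   is large enough that one step at least doubles the first exponential, even
   after discounting, whatever the sign of the drift ([step_layer]), and
   [layer_bound] controls the growth of the second one ([step_layer2]). *)
Definition layer_rate := 1 + wald_exponent + 2 * (`|m| + 1 + r) / v.
Definition layer_bound := expR (2 * layer_rate ^+ 2 * v + 2 * layer_rate * `|m|).

Lemma layer_rate_ge : [/\ 1 <= layer_rate, wald_exponent <= layer_rate &
  2 * (`|m| + 1 + r) <= layer_rate * v].
Proof.
have t0 := wald_exponent_gt0.
have q0 : 0 < 2 * (`|m| + 1 + r) / v.
  by rewrite divr_gt0// mulr_gt0// ltr_wpDl ?addr_ge0.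
rewrite /layer_rate; split; [lra|lra|].
set Q := 2 * (`|m| + 1 + r).
have : Q / v * v = Q by rewrite divfK ?gt_eqF.
have := mulr_gt0 t0 v0; rewrite 2!mulrDl.
move=> h ->; rewrite mul1r lerDr ltW// addr_gt0//.
Qed.

Lemma layer_bound_ge1 : 1 <= layer_bound.
Proof.
have [l1 _ _] := layer_rate_ge.
rewrite -expR0 ler_expR addr_ge0// !mulr_ge0// ?ltW//; nra.
Qed.

(* b is the square root of the time step. *)
Variable b : R.
Hypothesis b01 : 0 < b <= 1.

Let b0 : 0 < b. Proof. by case/andP: b01. Qed.
Let b1 : b <= 1. Proof. by case/andP: b01. Qed.

Definition step_laplace a := expR (b ^+ 2 * log_laplace a).
Definition step_discount := expR (- (r * b ^+ 2)).

Lemma step_discount_lt1 : 0 < step_discount < 1.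
Proof. by rewrite expR_gt0 -expR0 ltr_expR oppr_lt0 mulr_gt0// exprn_gt0. Qed.

Lemma step_laplace0 : step_laplace 0 = 1.
Proof. by rewrite -expR0; congr expR; rewrite /log_laplace; ring. Qed.

Lemma step_wald : step_discount * step_laplace wald_exponent = 1.
Proof.
rewrite /step_laplace log_laplace_wald -expRD -[RHS]expR0; congr expR; ring.
Qed.

Lemma step_layer : 2 <= step_discount * step_laplace (layer_rate / b).
Proof.
have [l1 _ lv] := layer_rate_ge.
rewrite -expRD.
have -> : b ^+ 2 * log_laplace (layer_rate / b) = layer_rate * (layer_rate * v / 2 - m * b).
  by rewrite /log_laplace; field; rewrite gt_eqF.
apply: le_trans (expR_ge1Dx _).
have mb : m * b <= `|m|.
  apply: le_trans (ler_norm _) _.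
  by rewrite normrM (gtr0_norm b0) ler_piMr.
have h : 1 + r <= layer_rate * v / 2 - m * b by lra.
have h2 : 1 + r <= layer_rate * (layer_rate * v / 2 - m * b).
  by apply: (le_trans h); rewrite ler_peMl//; have := r0; lra.
have b2 : b ^+ 2 <= 1 by rewrite exprn_ile1// ltW.
have := ler_wpM2l (ltW r0) b2; lra.
Qed.

Lemma step_layer_ge2 : 2 <= step_laplace (layer_rate / b).
Proof.
apply: le_trans step_layer _; rewrite ler_piMl ?expR_ge0// ltW//.
by case/andP: step_discount_lt1.
Qed.

Lemma step_layer2 : step_laplace (2 * layer_rate / b) <= layer_bound.
Proof.
have [l1 _ lv] := layer_rate_ge.
rewrite ler_expR.
have -> : b ^+ 2 * log_laplace (2 * layer_rate / b) =
    2 * layer_rate ^+ 2 * v - 2 * layer_rate * (m * b).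
  by rewrite /log_laplace; field; rewrite gt_eqF.
have mb : - (m * b) <= `|m|.
  apply: le_trans (ler_norm _) _.
  by rewrite normrN normrM (gtr0_norm b0) ler_piMr.
have l0 : 0 <= 2 * layer_rate by lra.
have := ler_wpM2l l0 mb; lra.
Qed.

(** The weight for which [b * layer_weight] is the ratio of [wald_exponent] to
   [layer_rate / b], so that [expR_bernoulli] compares the two exponentials. *)
Definition layer_weight := wald_exponent / layer_rate.

Lemma layer_weight_bounds : 0 < layer_weight <= 1.
Proof.
have t0 := wald_exponent_gt0; have [l1 tl _] := layer_rate_ge.
have l0 : 0 < layer_rate by lra.
by rewrite divr_gt0//= ler_pdivrMr// mul1r.
Qed.

(** With [q] the exponential of rate [layer_rate / b], this is
   [1 - exp (- wald_exponent * y)] plus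
   [layer_weight * b * (layer_bound - q + q ^+ 2 / layer_bound)]. For [y < 0]
   the layer must absorb [exp (- wald_exponent * y) - 1], which is at most
   [layer_weight * b * q]; for [y >= 0] the term [- q] makes it
   superharmonic, and the term in [q ^+ 2] is too small to spoil that. *)
Definition upper_barrier : seq (R * R) :=
  [:: (1 + layer_weight * b * layer_bound, 0); (-1, wald_exponent);
      (- (layer_weight * b), layer_rate / b);
      (layer_weight * b / layer_bound, 2 * layer_rate / b)].

Let expR_layer2 y : expR (- (2 * layer_rate / b) * y) = expR (- (layer_rate / b) * y) ^+ 2.
Proof. by rewrite expr2 -expRD; congr expR; field; rewrite gt_eqF. Qed.

Lemma upper_barrierE y : expsum upper_barrier y = 1 - expR (- wald_exponent * y)
  + layer_weight * b * (layer_bound - expR (- (layer_rate / b) * y)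
                        + expR (- (layer_rate / b) * y) ^+ 2 / layer_bound).
Proof.
rewrite /expsum !big_cons big_nil/= addr0 oppr0 mul0r expR0 expR_layer2.
field; rewrite gt_eqF// (lt_le_trans _ layer_bound_ge1)//.
Qed.

Lemma upper_barrier_ge0 y : 0 <= expsum upper_barrier y.
Proof.
have K1 := layer_bound_ge1; have K0 : 0 < layer_bound by lra.
have /andP[k0 k1] := layer_weight_bounds; have t0 := wald_exponent_gt0.
have [l1 _ _] := layer_rate_ge.
have kb : 0 < layer_weight * b by rewrite mulr_gt0.
rewrite upper_barrierE; set q := expR (- (layer_rate / b) * y).
(* The constant term of the layer is chosen so that, even after the loss of
   another q, the remaining quadratic polynomial in q is a square. *)
have sq : 0 <= layer_bound - 2 * q + q ^+ 2 / layer_bound.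
  have -> : layer_bound - 2 * q + q ^+ 2 / layer_bound = (q - layer_bound) ^+ 2 / layer_bound.
    by field; rewrite gt_eqF.
  by rewrite divr_ge0 ?sqr_ge0// ltW.
have q0 : 0 <= q by exact: expR_ge0.
have [y0|y0] := leP 0 y.
  have e1 : expR (- wald_exponent * y) <= 1.
    by rewrite -expR0 ler_expR mulNr oppr_le0 mulr_ge0// ltW.
  have h : 0 <= layer_bound - q + q ^+ 2 / layer_bound by lra.
  have := mulr_ge0 (ltW kb) h; lra.
have p1 : 0 <= layer_weight * b <= 1 by rewrite (ltW kb)/= mulr_ile1// ltW.
have := @expR_bernoulli (layer_weight * b) (- (layer_rate / b) * y) p1.
have -> : layer_weight * b * (- (layer_rate / b) * y) = - wald_exponent * y.
  by rewrite /layer_weight; field; rewrite !gt_eqF//; lra.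
rewrite -/q => h.
have := mulr_ge0 (ltW kb) sq; lra.
Qed.

(** After the exact terms cancel, what remains is a positive multiple of
   [layer_bound * (1 - z) + q * (A1 - 1 - q * ((A2 - 1) / layer_bound))], with
   [A1 >= 2], [A2 <= layer_bound] and [q <= 1]. *)
Lemma upper_barrier_supersolution y : 0 <= y ->
  1 - step_discount <= expsum
    [seq (p.1 * (1 - step_discount * step_laplace p.2), p.2) | p <- upper_barrier] y.
Proof.
move=> y0.
have K1 := layer_bound_ge1; have K0 : 0 < layer_bound by lra.
have /andP[k0 k1] := layer_weight_bounds.
have kb : 0 < layer_weight * b by rewrite mulr_gt0.
have /andP[z0 z1] := step_discount_lt1.
rewrite /expsum !big_cons big_nil/= addr0 step_wald subrr mulr0 mul0r add0r.
rewrite oppr0 mul0r expR0 mulr1 expR_layer2.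
rewrite step_laplace0.
set q := expR (- (layer_rate / b) * y).
have q0 : 0 < q by exact: expR_gt0.
have q1 : q <= 1.
  rewrite -expR0 ler_expR mulNr oppr_le0 mulr_ge0// divr_ge0 ?ltW//.
  by have [l1 _ _] := layer_rate_ge; lra.
have := step_layer; set A1 := _ * step_laplace (layer_rate / b) => h1.
set A2 := _ * step_laplace (2 * layer_rate / b).
have h2 : A2 <= layer_bound.
  apply: le_trans step_layer2; rewrite ler_piMl ?expR_ge0// ltW//.
have -> : (1 + layer_weight * b * layer_bound) * (1 - step_discount * 1) +
    (- (layer_weight * b) * (1 - A1) * q + layer_weight * b / layer_bound * (1 - A2) * q ^+ 2) =
    1 - step_discount + layer_weight * b * (layer_bound * (1 - step_discount) +
      q * (A1 - 1 - q * ((A2 - 1) / layer_bound))).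
  by field; rewrite gt_eqF.
have h3 : (A2 - 1) / layer_bound <= 1.
  by rewrite ler_pdivrMr// mul1r (le_trans _ h2)// lerBlDr lerDl.
have h4 : q * ((A2 - 1) / layer_bound) <= 1.
  have := ler_wpM2l (ltW q0) h3; rewrite mulr1 => h4.
  exact: le_trans h4 q1.
rewrite lerDl; apply: mulr_ge0; first exact: ltW.
apply: addr_ge0; first by apply: mulr_ge0; lra.
by apply: mulr_ge0; lra.
Qed.

Lemma upper_barrier_at0 : expsum upper_barrier 0 <= (layer_weight * layer_bound) * b.
Proof.
have K1 := layer_bound_ge1; have K0 : 0 < layer_bound by lra.
have /andP[k0 k1] := layer_weight_bounds.
rewrite upper_barrierE !mulr0 expR0 subrr add0r [leRHS]mulrAC expr1n div1r.
have K11 : layer_bound^-1 <= 1 by rewrite invf_le1.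
rewrite ler_wpM2l//; last lra.
by rewrite mulr_ge0// ltW.
Qed.

(** The slope for which the lower barrier stays below [- wald_exponent * y]
   when [y < 0]: with [t = q - 1], one has
   [t - t ^+ 2 / (2 * layer_bound) <= (1 + 2 * layer_bound) * ln (1 + t)]. *)
Definition lower_scale := wald_exponent / (layer_rate * (1 + 2 * layer_bound)).

(** With [q] the exponential of rate [layer_rate / b], this is
   [lower_scale * b * (q - 1 - (q - 1) ^+ 2 / (2 * layer_bound))]: it has the
   sign of [q - 1] near the boundary, is bounded above, and one step from [0]
   makes its expectation positive of order [b]. *)
Definition lower_barrier : seq (R * R) :=
  [:: (- (lower_scale * b * (1 + (2 * layer_bound)^-1)), 0);
      (lower_scale * b * (1 + 2 * (2 * layer_bound)^-1), layer_rate / b);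
      (- (lower_scale * b / (2 * layer_bound)), 2 * layer_rate / b)].

Lemma lower_scale_gt0 : 0 < lower_scale.
Proof.
have t0 := wald_exponent_gt0; have [l1 _ _] := layer_rate_ge; have K1 := layer_bound_ge1.
by rewrite divr_gt0// mulr_gt0//; lra.
Qed.

Lemma lower_barrierE y : expsum lower_barrier y =
  lower_scale * b * (expR (- (layer_rate / b) * y) - 1
    - (expR (- (layer_rate / b) * y) - 1) ^+ 2 / (2 * layer_bound)).
Proof.
rewrite /expsum !big_cons big_nil/= addr0 oppr0 mul0r expR0 expR_layer2.
field; rewrite gt_eqF// (lt_le_trans _ layer_bound_ge1)//.
Qed.

Lemma lower_barrier_le0 y : 0 <= y -> expsum lower_barrier y <= 0.
Proof.
move=> y0; rewrite lower_barrierE.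
have K1 := layer_bound_ge1; have [l1 _ _] := layer_rate_ge.
have q1 : expR (- (layer_rate / b) * y) <= 1.
  rewrite -expR0 ler_expR mulNr oppr_le0 mulr_ge0// divr_ge0 ?ltW//; lra.
apply: mulr_ge0_le0.
  by apply: mulr_ge0; apply: ltW => //; exact: lower_scale_gt0.
move: q1; set q := expR _ => q1.
have : 0 <= (q - 1) ^+ 2 / (2 * layer_bound) by rewrite divr_ge0 ?sqr_ge0//; lra.
lra.
Qed.

Lemma lower_barrier_le y : y < 0 ->
  expsum lower_barrier y <= expR (- wald_exponent * y) - 1.
Proof.
move=> y0; rewrite lower_barrierE.
have K1 := layer_bound_ge1; have [l1 _ _] := layer_rate_ge; have t0 := wald_exponent_gt0.
have ls := lower_scale_gt0.
set x := - (layer_rate / b) * y.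
have x0 : 0 < x by rewrite /x mulNr -mulrN mulr_gt0 ?divr_gt0 ?oppr_gt0//; lra.
apply: (@le_trans _ _ (- wald_exponent * y)); last first.
  by have := expR_ge1Dx (- wald_exponent * y); lra.
have -> : - wald_exponent * y = lower_scale * b * ((1 + 2 * layer_bound) * x).
  by rewrite /x /lower_scale; field; rewrite !gt_eqF//; lra.
rewrite (ler_pM2l (mulr_gt0 ls b0)).
set t := expR x - 1.
have t0' : 0 < t by rewrite subr_gt0 -expR0 ltr_expR.
(* ln (1 + t) >= t / (1 + t) *)
have xt : t <= x * (1 + t).
  have : 1 - x <= expR (- x) by exact: expR_ge1Dx.
  rewrite expRN -(ler_pM2r (expR_gt0 x)) mulVf ?gt_eqF ?expR_gt0//.
  rewrite (_ : 1 + t = expR x) /t; lra.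
have h : (t - t ^+ 2 / (2 * layer_bound)) * (1 + t) <= (1 + 2 * layer_bound) * t.
  have -> : (t - t ^+ 2 / (2 * layer_bound)) * (1 + t) =
      t * ((1 - t / (2 * layer_bound)) * (1 + t)).
    by field; lra.
  rewrite mulrC ler_pM2r//.
  (* Beyond 2 * layer_bound the left-hand side is negative. *)
  have [tK|tK] := leP t (2 * layer_bound).
    have : 0 <= t / (2 * layer_bound) by rewrite divr_ge0; lra.
    nra.
  have : 1 < t / (2 * layer_bound) by rewrite ltr_pdivlMr ?mul1r//; lra.
  nra.
have t1 : 0 < 1 + t by lra.
rewrite -(ler_pM2r t1); apply: (le_trans h).
by rewrite -mulrA ler_pM2l//; lra.
Qed.

Lemma lower_barrier_gain :
  expR (- r) * lower_scale / 2 * b <=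
  step_discount * \sum_(p <- lower_barrier) p.1 * step_laplace p.2.
Proof.
have K1 := layer_bound_ge1; have ls := lower_scale_gt0.
have h : lower_scale * b / 2 <= \sum_(p <- lower_barrier) p.1 * step_laplace p.2.
  rewrite !big_cons big_nil/= addr0.
  rewrite step_laplace0.
  have := step_layer_ge2; set A1 := step_laplace (layer_rate / b) => h1.
  have := step_layer2; set A2 := step_laplace (2 * layer_rate / b) => h2.
  have -> : - (lower_scale * b * (1 + (2 * layer_bound)^-1)) * 1 +
    (lower_scale * b * (1 + 2 * (2 * layer_bound)^-1) * A1 +
     - (lower_scale * b / (2 * layer_bound)) * A2)
    = lower_scale * b * (A1 - 1 - (A2 - 2 * A1 + 1) / (2 * layer_bound)) by field; lra.
  rewrite (ler_pM2l (mulr_gt0 ls b0)).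
  have : (A2 - 2 * A1 + 1) / (2 * layer_bound) <= 2^-1 by rewrite ler_pdivrMr; lra.
  lra.
have zr : expR (- r) <= step_discount.
  by rewrite ler_expR lerN2 ler_piMr ?(ltW r0)// exprn_ile1// ltW.
have -> : expR (- r) * lower_scale / 2 * b = expR (- r) * (lower_scale * b / 2).
  by field.
apply: ler_pM => //.
by rewrite ltW// divr_gt0// (mulr_gt0 ls b0).
Qed.

End barriers.
(** * Discounting at the hitting time *)

Section discounting.
Context {d : nat} {disp : measure_display} {T : measurableType disp} {R : realType}.
Variables (X : R -> T -> 'cV[R]_d) (G : set 'cV[R]_d) (r s : R).
Hypotheses (r0 : 0 < r) (s0 : 0 < s).

Let z := expR (- (r * s)).

Definition avoids n : set T := [set w | forall k, (k < n)%N -> ~ G (X (k.+1%:R * s) w)].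

Let sum_geometric (q : R) n : (1 - q) * \sum_(k < n) q ^+ k = 1 - q ^+ n.
Proof. by rewrite -[LHS]opprK -mulNr opprB -subrX1 opprB. Qed.

(** With [N] the first index at which [G] is hit, the discount is [z ^+ N] and
   the sum telescopes to [1 - z ^+ minn N n], also when [N] is infinite. *)
Lemma discount_hitting_time n w :
  let e := 1 - discount r (hitting_time X G s w)
           - (1 - z) * \sum_(k < n) z ^+ k * \1_(avoids k) w in
  0 <= e <= z ^+ n.
Proof.
have z0 : 0 < z by exact: expR_gt0.
have z1 : z <= 1 by rewrite -expR0 ler_expR oppr_le0 mulr_ge0// ltW.
have [[k0 Gk0]|noG] := pselect (exists k, G (X (k.+1%:R * s) w)); last first.
  have av k : \1_(avoids k) w = 1 :> R.
    by rewrite indicE mem_set// => j _ Gj; apply: noG; exists j.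
  have -> : hitting_time X G s w = +oo%E.
    rewrite /hitting_time [X in ereal_inf X](_ : _ = set0) ?ereal_inf0//.
    rewrite -subset0 => x [n' [n0 Gn] _]; apply: noG.
    by exists n'.-1; rewrite prednK.
  rewrite /discount gt0_muley ?lte_fin//= subr0.
  under eq_bigr do rewrite av mulr1.
  by rewrite /= sum_geometric opprB addrC subrK lexx exprn_ge0// ltW.
pose p k := `[< G (X (k.+1%:R * s) w) >].
have exp : exists k, p k by exists k0; exact/asboolP.
case: (ex_minnP exp) => N /asboolP GN Nmin.
have av k : \1_(avoids k) w = (k <= N)%N%:R :> R.
  rewrite indicE; congr (nat_of_bool _)%:R; apply/idP/idP.
    move=> /set_mem h; rewrite leqNgt; apply/negP => Nk; exact: h Nk GN.
  move=> kN; apply: mem_set => j jk Gj.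
  have := Nmin j; rewrite /p => /(_ (asboolT Gj)) Nj.
  by have := leq_ltn_trans Nj (leq_trans jk kN); rewrite ltnn.
have -> : hitting_time X G s w = (N.+1%:R * s)%:E.
  apply/eqP; rewrite eq_le; apply/andP; split.
    by apply: ereal_inf_lbound; exists N.+1.
  apply: le_ereal_inf_tmp => _ [n' [n0 Gn] <-]; rewrite lee_fin ler_pM2r// ler_nat.
  case: n' n0 Gn => // n' _ Gn; rewrite ltnS; apply: Nmin; exact/asboolP.
have -> : discount r (N.+1%:R * s)%:E = z ^+ N.+1.
  by rewrite /discount -EFinM -EFinN/= -expRM_natl; congr expR; ring.
under eq_bigr do rewrite av.
have [nN|Nn] := leqP n N.+1.
  rewrite (eq_bigr (fun k : 'I_n => z ^+ k)); last first.
    by move=> k _; rewrite -ltnS (leq_trans (ltn_ord k) nN) mulr1.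
  rewrite /= sum_geometric.
  have : z ^+ N.+1 <= z ^+ n by rewrite ler_wiXn2l// ltW.
  have : 0 <= z ^+ N.+1 by rewrite exprn_ge0// ltW.
  lra.
rewrite -(subnKC (ltnW Nn)) big_split_ord/=.
rewrite (eq_bigr (fun k : 'I_N.+1 => z ^+ k)); last first.
  by move=> k _; rewrite -ltnS ltn_ord mulr1.
rewrite [X in _ * (_ + X)]big1; last first.
  by move=> k _; rewrite leqNgt ltn_addr//= mulr0.
rewrite addr0 sum_geometric subrr lexx exprn_ge0// ltW//.
Qed.

Variable P : probability T R.
Hypothesis mG : forall k, measurable [set w | G (X (k.+1%:R * s) w)].

Lemma measurable_avoids n : measurable (avoids n).
Proof.
rewrite (_ : avoids n = \bigcap_(k in `I_n) ~` [set w | G (X (k.+1%:R * s) w)]).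
  by apply: bigcap_measurableType => // k _; exact: measurableC.
by apply/seteqP; split.
Qed.

Definition discounted_hitting w := discount r (hitting_time X G s w).

Let partial n w := (1 - z) * \sum_(k < n) z ^+ k * (\1_(avoids k) w : R).

Let measurable_partial n : measurable_fun setT (partial n).
Proof.
apply: measurable_funM => //; apply: measurable_sum => k.
by apply: measurable_funM => //; apply: measurable_indic; exact: measurable_avoids.
Qed.

Let cvg_geom : z ^+ n @[n --> \oo] --> (0 : R).
Proof.
by apply: cvg_expr; rewrite gtr0_norm ?expR_gt0// -expR0 ltr_expR oppr_lt0 mulr_gt0.
Qed.

(** The infimum defining the hitting time is avoided: by
   [discount_hitting_time], the discount is a limit of finite combinations of
   indicators. *)
Lemma measurable_discounted_hitting : measurable_fun setT discounted_hitting.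
Proof.
have -> : discounted_hitting = (fun w => 1 - (1 - discounted_hitting w)).
  by apply/funext => w; rewrite opprB addrC subrK.
apply: measurable_funB => //.
apply: (measurable_fun_cvg (h := partial)) => [n|w _]; first exact: measurable_partial.
apply/cvgrPdist_le => e e0.
have /cvgrPdist_le/(_ _ e0) := cvg_geom; apply: filterS => n.
rewrite sub0r normrN => h; apply: le_trans h.
have /andP[h1 h2] := discount_hitting_time n w.
by rewrite ger0_norm// (le_trans h2)// ler_norm.
Qed.

Lemma discounted_hitting_bounds w : 0 <= discounted_hitting w <= 1.
Proof.
apply/andP; split; first by rewrite fine_ge0// expeR_ge0.
have /andP[] := discount_hitting_time 0 w.
by rewrite big_ord0 mulr0 subr0 subr_ge0.
Qed.

Lemma integrable_discounted_hitting :
  P.-integrable setT (EFin \o discounted_hitting).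
Proof.
apply: (@le_integrable _ _ _ P setT measurableT _ (EFin \o cst 1)) => //.
- by apply/measurable_EFinP; exact: measurable_discounted_hitting.
- move=> w _; have /andP[h1 h2] := discounted_hitting_bounds w.
  by rewrite /= lee_fin normr1 ger0_norm.
- exact: finite_measure_integrable_cst.
Qed.

Lemma expected_discount_bounds n :
  let e := 1 - \int[P]_w discounted_hitting w
           - (1 - z) * \sum_(k < n) z ^+ k * fine (P (avoids k)) in
  0 <= e <= z ^+ n.
Proof.
have icst (c : R) : P.-integrable setT (EFin \o cst c).
  exact: finite_measure_integrable_cst.
have Ecst (c : R) : \int[P]_w cst c w = c.
  rewrite Rintegral_cst; last exact: measurableT.
  by rewrite (congr1 fine (probability_setT P)) mulr1.
have [ip Ep] : P.-integrable setT (EFin \o partial n) /\ \int[P]_w partial n w =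
    (1 - z) * \sum_(k < n) z ^+ k * fine (P (avoids k)).
  rewrite /partial; elim: n => [|n [IHi IHE]].
    rewrite big_ord0 mulr0 (_ : (fun _ => _) = cst 0) ?Ecst//.
    by apply/funext => w; rewrite big_ord0 mulr0.
  have i1 : P.-integrable setT (EFin \o (\1_(avoids n) : T -> R)).
    exact: integrable_indic (measurable_avoids n).
  have i2 : P.-integrable setT
      (EFin \o (fun w => (1 - z) * z ^+ n * (\1_(avoids n) w : R))).
    rewrite (_ : _ \o _ = fun w =>
      (((1 - z) * z ^+ n)%:E * (\1_(avoids n) w)%:E)%E)//.
    exact: integrableZl.
  rewrite (_ : (fun _ => _) = (fun w => (1 - z) * \sum_(k < n) z ^+ k * \1_(avoids k) w
      + (1 - z) * z ^+ n * \1_(avoids n) w)); last first.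
    by apply/funext => w; rewrite big_ord_recr/= mulrDr mulrA.
  split.
    rewrite (_ : _ \o _ = fun w =>
      (((1 - z) * \sum_(k < n) z ^+ k * \1_(avoids k) w)%R%:E +
       ((1 - z) * z ^+ n * \1_(avoids n) w)%R%:E)%E)//.
    exact: integrableD.
  rewrite RintegralD// IHE RintegralZl//.
  rewrite /Rintegral integral_indic ?setIT//; last exact: measurable_avoids.
  by rewrite big_ord_recr/= mulrDr mulrA.
have ih := integrable_discounted_hitting.
have iB : P.-integrable setT
    (EFin \o (fun w => cst 1 w - discounted_hitting w)).
  rewrite (_ : _ \o _ = fun w => ((cst 1 w)%:E - (discounted_hitting w)%:E)%E)//.
  by apply: integrableB => //; exact: icst.
have iBB : P.-integrable setT
    (EFin \o (fun w => cst 1 w - discounted_hitting w - partial n w)).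
  rewrite (_ : _ \o _ = fun w =>
    ((cst 1 w - discounted_hitting w)%R%:E - (partial n w)%:E)%E)//.
  exact: integrableB.
rewrite -Ep -[X in X - _ - _]Ecst -RintegralB// -RintegralB//.
apply/andP; split.
  apply: Rintegral_ge0 => w _.
  by have /andP[] := discount_hitting_time n w.
rewrite -[leRHS]Ecst; apply: le_Rintegral => // w _.
by have /andP[] := discount_hitting_time n w.
Qed.

End discounting.
(** * Brownian increments on a grid *)

Lemma prod_ord_block (R : realType) (F : nat -> \bar R) n d :
  (\prod_(j < n * d) F j = \prod_(k < n) \prod_(i < d) F (k * d + i)%N)%E.
Proof.
elim: n => [|n IH]; first by rewrite mul0n !big_ord0.
by rewrite mulSnr big_split_ord/= IH big_ord_recr.
Qed.

Section increments.
Context {R : realType} {disp : measure_display} {T : measurableType disp}.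
Context {d : nat} {P : probability T R} {B : 'I_d -> R -> T -> R}.
Hypothesis brB : forall i, brownian_motion P (B i).
Hypothesis indB : mutually_independent P (fun i => sigma_process (B i)).
Hypothesis d0 : (0 < d)%N.
Variable s : R.
Hypothesis s0 : 0 < s.

(** The increments over all steps [k] and coordinates [i] are listed in one
   sequence, the pair [(k, i)] having index [k * d + i], so that the past before
   step [k] is the past of that sequence before [k * d]. *)
Definition coordinate j : 'I_d := Ordinal (ltn_pmod j d0).

Definition increment (k : nat) (i : 'I_d) (w : T) : R :=
  B i (k.+1%:R * s) w - B i (k%:R * s) w.

Definition flat_increment j := increment (j %/ d) (coordinate j).

Let time_ge0 k : 0 <= k%:R * s. Proof. by rewrite mulr_ge0// ltW. Qed.

Let time_lt k : k%:R * s < k.+1%:R * s.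
Proof. by rewrite ltr_pM2r// ltr_nat. Qed.

Lemma measurable_increment k i : measurable_fun setT (increment k i).
Proof. by apply: measurable_funB; apply: (bm_measurable (brB i)); exact: time_ge0. Qed.

Let V j : {mfun T >-> R} :=
  mfun_Sub (mem_set (measurable_increment (j %/ d) (coordinate j))).

Lemma flat_index k (i : 'I_d) : coordinate (k * d + i) = i /\ ((k * d + i) %/ d)%N = k.
Proof.
split; first by apply: val_inj; rewrite /= modnMDl modn_small.
by rewrite divnMDl// divn_small// addn0.
Qed.

Lemma increment_sigma_process k i (E : set R) : measurable E ->
  sigma_process (B i) (increment k i @^-1` E).
Proof.
move=> mE.
pose S := \bigcup_(t in `[0, +oo[) preimage_set_system setT (B i t) measurable.
have mB t : 0 <= t -> measurable_fun [set: g_sigma_algebraType S] (B i t).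
  move=> t0 _ E' mE'; apply: sub_sigma_algebra; exists t.
    by rewrite /= in_itv/= t0.
  by exists E'.
have : measurable_fun [set: g_sigma_algebraType S] (increment k i).
  by apply: measurable_funB; apply: mB.
by move=> /(_ measurableT E mE); rewrite setTI.
Qed.

Lemma increments_coordinate n i (E : nat -> set R) : (forall k, measurable (E k)) ->
  P (\bigcap_(k in `I_n) increment k i @^-1` E k) =
  (\prod_(k < n) P (increment k i @^-1` E k))%E.
Proof.
move=> mE.
have := bm_increments (brB i) (n := n) (time_ge0 0) (fun k _ => time_lt k).
move=> /(_ [set: 'I_n]%SET (fun k => increment k i @^-1` E k)).
rewrite (_ : \bigcap_(k in _) _ = \bigcap_(k in `I_n) increment k i @^-1` E k); last first.
  apply/seteqP; split => w h k.
    by move=> kn; apply: (h (Ordinal kn)); rewrite /= inE.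
  by move=> _; exact: (h k (ltn_ord k)).
rewrite (eq_bigl predT); last by move=> k; rewrite inE.
by apply => k _; exists (E k) => //; rewrite setTI.
Qed.

(** Independence across coordinates first, then across steps for each
   coordinate. *)
Lemma flat_increments_block n (E : nat -> set R) : (forall k, measurable (E k)) ->
  P (\bigcap_(j in `I_(n * d)) flat_increment j @^-1` E j) =
  (\prod_(j < n * d) P (flat_increment j @^-1` E j))%E.
Proof.
move=> mE; rewrite (prod_ord_block _ (fun j => P (flat_increment j @^-1` E j))) exchange_big/=.
pose A (i : 'I_d) := \bigcap_(k in `I_n) increment k i @^-1` E (k * d + i)%N.
rewrite (_ : \bigcap_(j in _) _ = \bigcap_(i in [set` [set: 'I_d]%SET]) A i); last first.
  apply/seteqP; split => w h.
    move=> i _ k /= kn; have := h (k * d + i)%N.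
    rewrite /flat_increment; have [-> ->] := flat_index k i; apply.
    by rewrite /= (leq_trans _ (leq_mul kn (leqnn d)))// mulSnr ltn_add2l.
  move=> j /= jn; have := h (coordinate j).
  rewrite /= inE => /(_ isT (j %/ d)%N).
  by rewrite /= -divn_eq; apply; rewrite ltn_divLR.
rewrite indB; last first.
  move=> i _.
  pose S := \bigcup_(t in `[0, +oo[) preimage_set_system setT (B i t) measurable.
  apply: (@bigcap_measurableType _ (g_sigma_algebraType S)) => // k _.
  exact: increment_sigma_process.
apply: eq_big => [i|i _]; first by rewrite inE.
rewrite increments_coordinate//; apply: eq_bigr => k _.
by rewrite /flat_increment; have [-> ->] := flat_index k i.
Qed.

Lemma independent_flat_increments : independent_seq P (fun j => V j).
Proof.
move=> n E mE.
(* A block of full steps is completed with trivial events. *)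
pose E' j := if (j < n)%N then E j else setT.
have mE' j : measurable (E' j) by rewrite /E'; case: ifP.
have nd : (n <= n * d)%N by rewrite leq_pmulr.
have := flat_increments_block n E' mE'.
rewrite (_ : \bigcap_(j in _) _ = \bigcap_(j in `I_n) V j @^-1` E j); last first.
  apply/seteqP; split => w h j /= jn.
    by have := h j (leq_trans jn nd); rewrite /E' jn.
  by rewrite /E'; case: ifPn => // jn'; exact: h.
move=> ->; rewrite -(subnKC nd) big_split_ord/=.
rewrite [X in (_ * X)%E]big1 ?mule1.
  by apply: eq_bigr => j _; rewrite /E' ltn_ord.
move=> j _; rewrite /E' ltnNge leq_addr/= preimage_setT; exact: probability_setT.
Qed.

Lemma mgf_flat_increment j b :
  (\int[P]_w (expR (b * V j w))%:E = (expR (b ^+ 2 * s / 2))%:E)%E.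
Proof.
rewrite -mgf_normal//.
(* normal_prob lives on measurableTypeR R, which carries the Borel sets under
   another display than R itself: the law of the increment is taken there. *)
have mW : measurable_fun setT (V j : T -> measurableTypeR R).
  exact: measurable_increment.
pose W : {mfun T >-> measurableTypeR R} := @mfun_Sub _ _ T (measurableTypeR R) (V j) (mem_set mW).
have mexp : measurable_fun [set: measurableTypeR R] (fun x : R => (expR (b * x))%:E).
  by apply/measurable_EFinP/measurableT_comp => //; exact: measurable_funM.
transitivity (\int[distribution P W]_x (expR (b * x))%:E)%E.
  by rewrite ge0_integral_distribution// => x; rewrite lee_fin expR_ge0.
apply: eq_measure_integral => A mA _.
have := bm_gaussian (brB (coordinate j)) (time_ge0 (j %/ d)) (time_lt (j %/ d)) mA.
rewrite (_ : _ - _ = s) => [h|]; first exact: h.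
by rewrite -natr1; ring.
Qed.

End increments.
(** * The distance to the boundary along the grid *)

Lemma innerE (R : realType) (d : nat) (a x : 'cV[R]_d) :
  inner a x = \sum_(i < d) a i 0 * x i 0.
Proof. by rewrite /inner mxE; apply: eq_bigr => i _; rewrite mxE. Qed.

Section skeleton.
Context {R : realType} {disp : measure_display} {T : measurableType disp}.
Context {d : nat} {P : probability T R} {B : 'I_d -> R -> T -> R}.
Hypothesis brB : forall i, brownian_motion P (B i).
Hypothesis indB : mutually_independent P (fun i => sigma_process (B i)).
Hypothesis d0 : (0 < d)%N.
Variables (sigma alpha mu : 'cV[R]_d) (s : R).
Hypothesis s0 : 0 < s.

Let V j : {mfun T >-> R} := mfun_Sub
  (mem_set (measurable_increment brB s s0 (j %/ d) (coordinate d0 j))).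

Let c j := let i := coordinate d0 j in alpha i 0 * sigma i 0.

(** The values at the times [n * s] of [inner alpha (X - gamma)], rebuilt from
   the increments so that its adaptedness is visible. *)
Definition skeleton n w : R := walk V c (n * d) w + inner alpha mu * (n%:R * s).

Let v := \sum_(i < d) (alpha i 0 * sigma i 0) ^+ 2.

Lemma skeleton0 w : skeleton 0 w = 0.
Proof. by rewrite /skeleton /walk mul0n big_ord0 mul0r mulr0 addr0. Qed.

Lemma measurable_skeleton n : measurable_fun setT (skeleton n).
Proof. by apply: measurable_funD => //; exact: measurable_walk. Qed.

Lemma cylinder_alive n : <<s cylinder V (n * d) >> (alive skeleton n).
Proof.
pose TT := g_sigma_algebraType (cylinder V (n * d)).
rewrite (_ : alive _ n = \bigcap_(k in `I_n) skeleton k.+1 @^-1` `[0, +oo[); last first.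
  apply/seteqP; split => w h k /=.
    by rewrite in_itv/= andbT => kn; exact: h.
  by move=> kn; have := h k kn; rewrite /= in_itv/= andbT.
apply: (@bigcap_measurableType _ TT) => // k kn.
have : measurable_fun [set: g_sigma_algebraType (cylinder V (k.+1 * d))] (skeleton k.+1).
  by apply: measurable_funD => //; exact: past_measurable_walk.
move=> /(_ measurableT `[0, +oo[%classic (measurable_itv _)); rewrite setTI.
have : (k.+1 * d <= n * d)%N by rewrite leq_mul2r kn orbT.
move=> /subnKC <-; elim: (n * d - k.+1 * d)%N => [|m IH h]; first by rewrite addn0.
rewrite addnS; apply: (sub_sigma_algebra2 _ (IH h)) => A.
exact: cylinderS.
Qed.

(** Steps [n * d] to [n.+1 * d] of the flat sequence make one step of the
   skeleton, and the squares of their coefficients add up to [v]. *)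
Lemma integral_skeletonS n a :
  (\int[P]_(w in alive skeleton n) (expR (- a * skeleton n.+1 w))%:E =
   (\int[P]_(w in alive skeleton n) (expR (- a * skeleton n w))%:E) *
   (expR (s * log_laplace v (inner alpha mu) a))%:E)%E.
Proof.
set m := inner alpha mu.
have mA : measurable (alive skeleton n).
  by apply: (past_measurable V (n * d)); exact: cylinder_alive.
have drift k : (\int[P]_(w in alive skeleton n) (expR (- a * skeleton k w))%:E =
    (\int[P]_(w in alive skeleton n) (expR (- a * walk V c (k * d) w))%:E) *
     (expR (- a * (m * (k%:R * s))))%:E)%E.
  rewrite -ge0_integralZr//.
  - by apply: eq_integral => w _; rewrite mulrDr expRD.
  - apply/measurable_EFinP/measurableT_comp => //.
    by apply: measurable_funM => //; apply: measurable_funTS; exact: measurable_walk.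
apply: (etrans (drift n.+1)).
apply: (etrans _ (congr1 (fun x => (x * (expR (s * log_laplace v m a))%:E)%E)
  (esym (drift n)))).
rewrite mulSnr.
rewrite (integral_walk_shift P V (independent_flat_increments brB indB d0 s s0) c s
  (mgf_flat_increment brB d0 s s0)); last exact: cylinder_alive.
rewrite -!muleA -!EFinM -!expRD; congr (_ * (expR _)%:E)%E.
have -> : \sum_(k < d) c (n * d + k)%N ^+ 2 = v.
  by apply: eq_bigr => i _; rewrite /c; have [-> _] := flat_index d0 n i.
by rewrite /log_laplace -natr1; field.
Qed.

Lemma skeletonE n w : skeleton n w =
  inner alpha (\col_i (sigma i 0 * (B i (n%:R * s) w - B i 0 w) + mu i 0 * (n%:R * s))).
Proof.
rewrite /skeleton [RHS]innerE.
under [RHS]eq_bigr do rewrite mxE mulrDr.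
rewrite big_split/= innerE mulr_suml; congr (_ + _); last first.
  by apply: eq_bigr => i _; rewrite -!mulrA.
elim: n => [|n IH].
  rewrite mul0n /walk big_ord0 big1// => i _; by rewrite mul0r subrr !mulr0.
rewrite mulSnr /walk big_split_ord/= -/(walk V c (n * d) w) IH -big_split/=.
apply: eq_bigr => i _; rewrite /c /increment; have [-> ->] := flat_index d0 n i.
by rewrite /increment; ring.
Qed.

End skeleton.
(** * The Black-Scholes model started on the boundary *)

Lemma halfspaceE (R : realType) (d : nat) (gamma alpha x : 'cV[R]_d) :
  halfspace gamma alpha x <-> inner alpha (x - gamma) < 0.
Proof.
split=> [[y ay <-]|h]; first by rewrite addrC addKr.
by exists (x - gamma) => //; rewrite addrC subrK.
Qed.

Lemma eq_probability_ae {disp : measure_display} {T : measurableType disp}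
    {R : realType} (P : probability T R) (A B : set T) :
  measurable A -> measurable B -> {ae P, forall w, A w <-> B w} -> P A = P B.
Proof.
move=> mA mB AB.
have E C : measurable C -> P C = (\int[P]_w (\1_C w)%:E)%E.
  by move=> mC; rewrite integral_indic// setIT.
rewrite !E//; apply: ae_eq_integral => //.
- exact/measurable_EFinP/measurable_indic.
- exact/measurable_EFinP/measurable_indic.
- apply: filterS AB => w AB _; rewrite !indicE; congr (_%:R%:E).
  by congr nat_of_bool; apply/idP/idP => /set_mem/AB/mem_set.
Qed.

Section black_scholes_passage.
Context {R : realType} {disp : measure_display} {T : measurableType disp} {d : nat}.
Variables (r : R) (sigma : 'cV[R]_d) (P : 'cV[R]_d -> probability T R).
Variables (X : R -> T -> 'cV[R]_d).
Hypothesis sigma0 : forall i, 0 < sigma i 0.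
Hypothesis BS : black_scholes r sigma P X.
Variables gamma alpha : 'cV[R]_d.
Hypothesis alpha0 : alpha != 0.

Let G := halfspace gamma alpha.
Let mu := bs_drift r sigma.
Let m := inner alpha mu.
Let v := \sum_(i < d) (alpha i 0 * sigma i 0) ^+ 2.

Lemma alpha_coordinate_neq0 : exists i, alpha i 0 != 0.
Proof.
apply/existsP; apply: contraNT alpha0; rewrite negb_exists => /forallP h.
by apply/eqP/colP => i; rewrite mxE; have := h i; rewrite negbK => /eqP.
Qed.

Lemma dimension_gt0 : (0 < d)%N.
Proof. by have [i _] := alpha_coordinate_neq0; apply: leq_ltn_trans (ltn_ord i). Qed.

Lemma volatility_gt0 : 0 < v.
Proof.
have [i ai] := alpha_coordinate_neq0.
rewrite /v (bigD1 i)//= ltr_pwDl//.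
  by rewrite exprn_even_gt0//= mulf_neq0// gt_eqF.
by apply: sumr_ge0 => j _; exact: sqr_ge0.
Qed.

Lemma measurable_halfspace_hit t : 0 <= t -> measurable [set w | G (X t w)].
Proof.
move=> t0.
have mY : measurable_fun setT (fun w => \sum_(i < d) alpha i 0 * (X t w i 0 - gamma i 0)).
  apply: measurable_sum => i; apply: measurable_funM => //.
  by apply: measurable_funB => //; exact: (bs_measurable BS).
have := mY measurableT `]-oo, 0[%classic (measurable_itv _); rewrite setTI.
rewrite (_ : _ @^-1` _ = [set w | G (X t w)])//.
have E w : \sum_(i < d) alpha i 0 * (X t w i 0 - gamma i 0) = inner alpha (X t w - gamma).
  by rewrite innerE; apply: eq_bigr => i _; rewrite !mxE.
apply/seteqP; split => w /=; rewrite in_itv/= E => h; first exact/halfspaceE.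
exact/halfspaceE.
Qed.

(** The skeleton agrees with [inner alpha (X - gamma)] only almost surely, which
   is enough for the survival probabilities. *)
Lemma halfspace_walk_representation s : 0 < s <= 1 ->
  exists Y : nat -> T -> R,
    [/\ forall n, measurable_fun setT (Y n), forall w, Y 0 w = 0,
        forall n a,
        (\int[P gamma]_(w in alive Y n) (expR (- a * Y n.+1 w))%:E =
         (\int[P gamma]_(w in alive Y n) (expR (- a * Y n w))%:E) *
         (step_laplace v m (Num.sqrt s) a)%:E)%E &
        forall n, P gamma (avoids X G s n) = P gamma (alive Y n)].
Proof.
move=> /andP[s0 s1].
have [B [brB indB dyn]] := bs_dynamics BS gamma.
pose Y := skeleton (d := d) brB dimension_gt0 sigma alpha mu s s0.
exists Y.
have mY n : measurable_fun setT (Y n) by exact: measurable_skeleton.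
split => //.
- by move=> w; exact: skeleton0.
- move=> n a; rewrite /step_laplace sqr_sqrtr ?(ltW s0)//.
  exact: integral_skeletonS.
move=> n; apply: eq_probability_ae.
- apply: measurable_avoids => k; apply: measurable_halfspace_hit.
  by rewrite mulr_ge0// ltW.
- exact: measurable_alive.
have B0 : {ae P gamma, forall w, forall i, B i 0 w = 0}.
  by apply: filter_forall => i; exact: bm_start (brB i).
apply: filterS3 (bs_start BS gamma) B0 dyn => w X0 B00 Xt.
have E k : G (X (k.+1%:R * s) w) <-> Y k.+1 w < 0.
  have -> : Y k.+1 w = inner alpha (X (k.+1%:R * s) w - gamma).
    rewrite /Y skeletonE; congr inner; apply/colP => i.
    rewrite !mxE Xt ?mulr_gt0// X0 B00 subr0 /mu /bs_drift !mxE; ring.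
  exact: halfspaceE.
split => h k kn; first by rewrite leNgt; apply/negP => /E; exact: h.
by move=> /E; rewrite ltNge h.
Qed.

End black_scholes_passage.

(** * The loss and the rate of convergence *)

Lemma le0_geometric (R : realType) (z x : R) : 0 < z < 1 ->
  (forall n, x <= z ^+ n) -> x <= 0.
Proof.
move=> /andP[z0 z1] h.
have zc : z ^+ n @[n --> \oo] --> (0 : R) by apply: cvg_expr; rewrite gtr0_norm.
by apply: (ler_cvg_to (cvg_cst x) zc); exact: nearW.
Qed.

Lemma eventually_right_le1 (R : realType) : \forall s \near (0 : R)^'+, 0 < s <= 1.
Proof.
near=> s; apply/andP; split => //; near: s; exact: nbhs_right_le.
Unshelve. all: by end_near. Qed.

Section first_passage_loss.
Context {R : realType} {disp : measure_display} {T : measurableType disp} {d : nat}.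
Variables (r : R) (sigma : 'cV[R]_d) (P : 'cV[R]_d -> probability T R).
Variables (X : R -> T -> 'cV[R]_d).
Hypothesis r0 : 0 < r.
Hypothesis sigma0 : forall i, 0 < sigma i 0.
Hypothesis BS : black_scholes r sigma P X.
Variables gamma alpha : 'cV[R]_d.
Hypothesis alpha0 : alpha != 0.

Let G := halfspace gamma alpha.
Let m := inner alpha (bs_drift r sigma).
Let v := \sum_(i < d) (alpha i 0 * sigma i 0) ^+ 2.

Definition discount_loss s := 1 - \int[P gamma]_w discounted_hitting X G r s w.

(** The loss differs from the discounted survival up to [n] by at most [z ^+ n],
   for every [n], so the bounds given by the two barriers pass to it. *)
Lemma discount_loss_bounds : exists c C : R, [/\ 0 < c, 0 < C & forall s, 0 < s <= 1 ->
  c * Num.sqrt s <= discount_loss s <= C * Num.sqrt s].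
Proof.
have v0 : 0 < v := volatility_gt0 sigma sigma0 alpha alpha0.
have ls := @lower_scale_gt0 R r v m r0 v0.
have /andP[k0 _] := @layer_weight_bounds R r v m r0 v0.
have K1 := @layer_bound_ge1 R r v m r0 v0.
exists (expR (- r) * lower_scale r v m / 2), (layer_weight r v m * layer_bound r v m); split.
- by rewrite divr_gt0// mulr_gt0// expR_gt0.
- by rewrite mulr_gt0// (lt_le_trans _ K1).
move=> s s01; have /andP[s0 s1] := s01.
have b01 : 0 < Num.sqrt s <= 1.
  by rewrite sqrtr_gt0 s0/= -(sqrtr1 R) ler_sqrt.
have [Y [mY Y0 Ystep PY]] := halfspace_walk_representation r sigma P X BS
  gamma alpha alpha0 s s01.
set z := step_discount r (Num.sqrt s).
have z01 : 0 < z < 1 := step_discount_lt1 r r0 _ b01.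
have zE : expR (- (r * s)) = z by rewrite /z /step_discount sqr_sqrtr// ltW.
have mG k : measurable [set w | G (X (k.+1%:R * s) w)].
  by apply: (measurable_halfspace_hit _ _ _ _ BS); rewrite mulr_ge0// ltW.
have W n : 0 <= discount_loss s - discounted_survival (P gamma) Y z n <= z ^+ n.
  have := expected_discount_bounds X G r s r0 s0 (P gamma) mG n.
  rewrite /= zE /discounted_survival /survival /discount_loss.
  by under eq_bigr do rewrite PY.
have Wle n : discounted_survival (P gamma) Y z n <= discount_loss s.
  by have /andP[+ _] := W n; rewrite subr_ge0.
apply/andP; split.
- rewrite -subr_le0; apply: (le0_geometric _ z _ z01) => n.
  have := @discounted_survival_ge _ _ _ (P gamma) Y mY Y0 _ Ystep z z01
    (wald_exponent r v m) (lower_barrier r v m (Num.sqrt s)) n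
    (ltW (wald_exponent_gt0 r v m r0 v0)) (step_wald r v m r0 v0 _) (step_laplace0 v m _)
    (lower_barrier_le0 r v m r0 v0 _ b01) (lower_barrier_le r v m r0 v0 _ b01).
  have := lower_barrier_gain r v m r0 v0 _ b01; rewrite -/z => gain low.
  have zn : z ^+ n.+1 <= z ^+ n.
    by have /andP[z0 z1] := z01; rewrite ler_wiXn2l// ltW.
  rewrite lerBlDr; apply: (le_trans gain); rewrite -lerBlDl.
  apply: le_trans (Wle n.+1); apply: le_trans low.
  by rewrite lerD2l lerN2.
- rewrite -subr_le0; apply: (le0_geometric _ z _ z01) => n.
  have up := discounted_survival_le (P gamma) Y mY Y0 _ Ystep z z01
    (upper_barrier r v m (Num.sqrt s)) n
    (upper_barrier_ge0 r v m r0 v0 _ b01)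
    (upper_barrier_supersolution r v m r0 v0 _ b01).
  have {}up := le_trans up (upper_barrier_at0 r v m r0 v0 _ b01).
  have /andP[_ Wn] := W n.
  by apply: le_trans Wn; rewrite lerD2l lerN2.
Qed.

Lemma expectation_discount_diff s t : 0 < s -> 0 < t ->
  ('E_(P gamma)[fun w => (discount r (hitting_time X G t w)
                          - discount r (hitting_time X G s w))%R] =
   (discount_loss s - discount_loss t)%:E)%E.
Proof.
move=> s0 t0.
have mG u : 0 < u -> forall k, measurable [set w | G (X (k.+1%:R * u) w)].
  by move=> u0 k; apply: (measurable_halfspace_hit _ _ _ _ BS); rewrite mulr_ge0// ltW.
have int u : 0 < u -> (P gamma).-integrable setT (EFin \o discounted_hitting X G r u).
  by move=> u0; exact: integrable_discounted_hitting (mG u u0).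
have fin u : 0 < u ->
    (\int[P gamma]_w (discounted_hitting X G r u w)%:E)%E =
    (\int[P gamma]_w discounted_hitting X G r u w)%:E.
  by move=> u0; rewrite fineK//; apply: integrable_fin_num => //; exact: int.
rewrite unlock.
under eq_integral do rewrite EFinB.
rewrite integralB//; [|exact: int|exact: int].
rewrite !fin// -EFinB /discount_loss; congr EFin; ring.
Qed.

(** The limit defining [rho] exists because the loss at [t] tends to [0], by the
   upper bound. *)
Lemma rho_discount_loss s : 0 < s -> rho r P X G s gamma = (discount_loss s)%:E.
Proof.
move=> s0; apply/cvg_lim => //.
have [c [C [c0 C0 cC]]] := discount_loss_bounds.
have l0 : discount_loss t @[t --> 0^'+] --> (0 : R).
  apply: (@squeeze_cvgr _ _ _ _ (cst 0) (fun t => C * Num.sqrt t)).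
  - apply: filterS (eventually_right_le1 R) => t t01.
    have /andP[h1 h2] := cC t t01; rewrite h2 andbT (le_trans _ h1)//.
    by rewrite mulr_ge0 ?(ltW c0) ?sqrtr_ge0.
  - exact: cvg_cst.
  - have sq : Num.sqrt t @[t --> (0 : R)^'+] --> (0 : R).
      apply: cvg_at_right_filter; rewrite -[X in _ --> X](sqrtr0 R).
      exact: sqrt_continuous.
    by have := cvgM (cvg_cst C) sq; rewrite mulr0; exact.
have h : (discount_loss s - discount_loss t)%:E @[t --> 0^'+] --> (discount_loss s)%:E.
  apply: cvg_EFin; first exact: nearW.
  by rewrite -[X in _ --> X]subr0; apply: cvgB => //; exact: cvg_cst.
apply: cvg_trans h; apply: near_eq_cvg.
apply: filterS (eventually_right_le1 R) => t /andP[t0 _].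
by rewrite expectation_discount_diff.
Qed.

End first_passage_loss.

Theorem corollary3p3 (R : realType) (disp : measure_display)
    (T : measurableType disp) (d : nat) (r : R) (r_gt0 : 0 < r)
    (sigma : 'cV[R]_d) (sigma_gt0 : forall i, 0 < sigma i 0)
    (P : 'cV[R]_d -> probability T R) (X : R -> T -> 'cV[R]_d)
    (BS : black_scholes r sigma P X)
    (gamma alpha : 'cV[R]_d) (alpha_neq0 : alpha != 0) :
  let G := halfspace gamma alpha in
  let delta := Num.sqrt (\sum_(i < d) `|alpha i 0 * sigma i 0| ^+ 2) in
  let mu := bs_drift r sigma in
  (0 <= inner alpha mu ->
    exists c0 C0 : R, [/\ 0 < c0, 0 < C0 &
      \forall s \near 0^'+,
        ((c0 * s `^ (1 / 2))%:E <= rho r P X G s gamma)%E /\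
        (rho r P X G s gamma <= (C0 * s `^ (1 / (2 * Num.sqrt 2)))%:E)%E]) /\
  (inner alpha mu <= 0 -> `|inner alpha mu| ^+ 2 / (2 * delta ^+ 2) < r ->
    exists c1 C1 : R, [/\ 0 < c1, 0 < C1 &
      \forall s \near 0^'+,
        ((c1 * s `^ (1 / Num.sqrt 2))%:E <= rho r P X G s gamma)%E /\
        (rho r P X G s gamma <= (C1 * s `^ (1 / 2))%:E)%E]).
Proof.
move=> G delta mu.
have [c [C [c0 C0 cC]]] :=
  discount_loss_bounds r sigma P X r_gt0 sigma_gt0 BS gamma alpha alpha_neq0.
have bounds s : 0 < s <= 1 ->
    ((c * s `^ (1 / 2))%:E <= rho r P X G s gamma)%E /\
    (rho r P X G s gamma <= (C * s `^ (1 / 2))%:E)%E.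
  move=> s01; have /andP[s0 _] := s01.
  rewrite (rho_discount_loss r sigma P X r_gt0 sigma_gt0 BS gamma alpha alpha_neq0 s s0).
  rewrite !lee_fin div1r powR12_sqrt; last exact: ltW.
  by have /andP[] := cC s s01.
have sqrt2 : 1 <= (Num.sqrt 2 : R) <= 2.
  have q : 0 <= (Num.sqrt 2 : R) by exact: sqrtr_ge0.
  have h : (Num.sqrt 2 : R) * Num.sqrt 2 = 2 by rewrite -expr2 sqr_sqrtr.
  by apply/andP; split; rewrite leNgt; apply/negP => ?; nra.
have /andP[q1 q2] := sqrt2; have q0 : 0 < (Num.sqrt 2 : R) by lra.
split=> [_|_ _]; exists c, C; split => //;
  apply: filterS (eventually_right_le1 R) => s s01; have [lo up] := bounds s s01.
(* s <= 1, and 1/2 lies between the two exponents. *)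
- split=> //; apply: (le_trans up).
  rewrite lee_fin ler_pM2l// ger_powR// ler_pM2l//.
  by rewrite lef_pV2 ?posrE ?mulr_gt0//; lra.
- split=> //; apply: le_trans lo.
  rewrite lee_fin ler_pM2l// ger_powR// ler_pM2l//.
  by rewrite lef_pV2 ?posrE.
Qed.
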